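(* Let $M$ be a matroid on $[n]$ of rank $r\geq2$, let $i,j\in[n]$, and let $f_k=\sum_{I\in\mathcal I(M),|I|=k}\prod_{i\in I}x_i$ for $k=0,1,\dots,r$. (i) If $i$ and $j$ are non-loops and $M$ has at least three parallel classes, then for every $\mathbf a\in\mathbb R^n_{>0}$, $$f_M(\mathbf a)\cdot(\partial_i\partial_jf_M)(\mathbf a)<2\Big(1-\frac1r\Big)(\partial_if_M)(\mathbf a)\cdot(\partial_jf_M)(\mathbf a).$$ (ii) For every $\mathbf a\in\mathbb R^n_{>0}$ and every integer $k$ with $1\le k\le r-1$ and $k+1\geq\mathrm{girth}(M)$, $$\frac{f_{k-1}(\mathbf a)}{\binom n{k-1}}\cdot\frac{f_{k+1}(\mathbf a)}{\binom n{k+1}}<\left(\frac{f_k(\mathbf a)}{\binom nk}\right)^2.$$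
   Context: $f_M=\sum_{B\in\mathcal B(M)}\prod_{i\in B}x_i$ is the basis generating polynomial, $\partial_i=\partial/\partial x_i$. Parallel classes are the classes of non-loop elements under ''equal or forming a 2-element circuit''. $\mathrm{girth}(M)=\min\{k: I_k(M)\ne\binom nk\}$ where $I_k(M)$ is the number of independent sets of size $k$ (the minimum circuit size). *)

(* Defs.v *)
From HB Require Import structures.
From mathcomp Require Import all_boot all_order all_algebra.
From mathcomp Require Import mpoly.
From mathcomp Require Import reals.

Set Implicit Arguments.
Unset Strict Implicit.
Unset Printing Implicit Defensive.

Import GRing.Theory.
Local Open Scope ring_scope.

Record matroid (n : nat) := Matroid {
  indep : {set {set 'I_n}};
  indep0 : set0 \in indep;
  indep_sub : forall I J : {set 'I_n},
    J \subset I -> I \in indep -> J \in indep;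
  indep_aug : forall I J : {set 'I_n},
    I \in indep -> J \in indep -> (#|I| < #|J|)%N ->
    exists2 x, x \in J :\: I & x |: I \in indep
}.

Section MatroidDefs.
Variables (n : nat) (M : matroid n).

Definition bases : {set {set 'I_n}} :=
  [set B | maxset [pred I | I \in indep M] B].

Definition rank : nat := \max_(I in indep M) #|I|.

Definition circuits : {set {set 'I_n}} :=
  [set C | minset [pred D | D \notin indep M] C].

Definition loop (i : 'I_n) : bool := [set i] \in circuits.

Definition parallel : rel 'I_n :=
  [rel i j | (i == j) || ([set i; j] \in circuits)].

(* [parallel] is an equivalence relation on the non-loops. *)
Definition parallel_classes : {set {set 'I_n}} :=
  equivalence_partition parallel [set i | ~~ loop i].

Definition indep_of_size (k : nat) : {set {set 'I_n}} :=
  [set I in indep M | #|I| == k].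

(* Sizes k > n satisfy #|indep_of_size k| = 0 = 'C(n, k), so only k <= n
   matters; n.+1 stands for the minimum of the empty set, i.e. the infinite
   girth of a matroid without circuits. *)
Definition girth : nat :=
  \big[minn/n.+1]_(k < n.+1 | #|indep_of_size k| != 'C(n, k)) k.

Variable R : realType.

Definition basis_poly : {mpoly R[n]} :=
  \sum_(B in bases) \prod_(i in B) 'X_i.

Definition indep_poly (k : nat) : {mpoly R[n]} :=
  \sum_(I in indep_of_size k) \prod_(i in I) 'X_i.

End MatroidDefs.

Arguments basis_poly {n} M R.
Arguments indep_poly {n} M R k.

(* Main.v *)
Require Import Defs.
From mathcomp Require Import all_boot all_order all_algebra.
From mathcomp Require Import mpoly.
From mathcomp Require Import reals.
From mathcomp Require Import ring lra zify.

Set Implicit Arguments.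
Unset Strict Implicit.
Unset Printing Implicit Defensive.

Import Order.TTheory GRing.Theory Num.Theory.
Local Open Scope ring_scope.

(** The quadratic forms given by the Hessians at [a] of the derivatives of the
    basis polynomial, and of a homogenisation of the independence polynomial by
    one extra variable [y], have at most one positive eigenvalue ([hyperbolic]).
    This is shown by induction on the degree. In degree two it is a weighted
    Cauchy-Schwarz inequality over the parallel classes of a contraction. In
    higher degree Euler's relation writes the Hessian as a positive combination
    of the Hessians of the contractions; these inequalities give
    [T ^ 3 >= T] for a selfadjoint operator [T], similar to the transition
    operator of a connected reversible Markov chain, and iterating the lazy
    chain shows that the form is nonpositive on the complement of [a].
    Both claims are then reversed Cauchy-Schwarz inequalities. Equality would
    give a kernel vector, which is also in the kernel of the Hessians of all
    contractions; looking at contractions of rank two for (i), and of degree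
    two for (ii), contradicts the hypotheses. *)

(** * Quadratic forms with at most one positive eigenvalue *)

Section Forms.
Variables (R : realFieldType) (V : finType).
Implicit Types (G : V -> V -> R) (a u v w z d : V -> R).

Definition app G v (i : V) : R := \sum_j G i j * v j.

Definition form G u v : R := \sum_i u i * app G v i.

(** For symmetric [G] with [form G a a > 0] this is the signature condition: exactly one positive
    eigenvalue. *)
Definition hyperbolic G a : Prop := forall v, form G v a = 0 -> form G v v <= 0.

Lemma eq_app G u v : u =1 v -> app G u =1 app G v.
Proof. by move=> uv i; apply: eq_bigr => j _; rewrite uv. Qed.

Lemma eq_form G u u' v v' : u =1 u' -> v =1 v' -> form G u v = form G u' v'.
Proof. by move=> uu vv; apply: eq_bigr => i _; rewrite uu (eq_app G vv). Qed.

Lemma app_lin G x u y v i :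
  app G (fun i => x * u i + y * v i) i = x * app G u i + y * app G v i.
Proof.
by rewrite /app !mulr_sumr -big_split; apply: eq_bigr => j _ /=; ring.
Qed.

Lemma form_linl G x u y v w :
  form G (fun i => x * u i + y * v i) w = x * form G u w + y * form G v w.
Proof.
by rewrite /form !mulr_sumr -big_split; apply: eq_bigr => j _ /=; ring.
Qed.

Lemma form_linr G x u y v w :
  form G w (fun i => x * u i + y * v i) = x * form G w u + y * form G w v.
Proof.
rewrite /form !mulr_sumr -big_split; apply: eq_bigr => j _ /=.
by rewrite app_lin; ring.
Qed.

Lemma formC G u v : (forall i j, G i j = G j i) -> form G u v = form G v u.
Proof.
move=> Gsym; rewrite /form /app.
under eq_bigr do rewrite mulr_sumr.
under [RHS]eq_bigr do rewrite mulr_sumr.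
rewrite exchange_big; apply: eq_bigr => i _; apply: eq_bigr => j _.
by rewrite Gsym; ring.
Qed.

Lemma form_quad G x u y v : (forall i j, G i j = G j i) ->
  let w i := x * u i + y * v i in
  form G w w = x ^+ 2 * form G u u + 2 * x * y * form G u v + y ^+ 2 * form G v v.
Proof.
move=> Gsym /=; rewrite form_linl !form_linr (formC v u Gsym); ring.
Qed.

(** Reversed Cauchy-Schwarz: hyperbolicity is tested on [w], the component of [v] orthogonal to [a],
    scaled to avoid a division. *)
Lemma hyperbolic_ineq G a v : (forall i j, G i j = G j i) ->
  hyperbolic G a -> 0 < form G a a ->
  form G v v * form G a a <= form G v a ^+ 2.
Proof.
move=> Gsym Ghyp aa_gt0.
pose w i := form G a a * v i + (- form G v a) * a i.
have /Ghyp : form G w a = 0 by rewrite form_linl; ring.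
rewrite form_quad //.
set A := form G a a in aa_gt0 *; set B := form G v a; set C := form G v v.
have -> : A ^+ 2 * C + 2 * A * - B * B + (- B) ^+ 2 * A = A * (C * A - B ^+ 2).
  by ring.
by rewrite pmulr_rle0 // subr_le0.
Qed.

(** The form is nonpositive on the complement of [a], so an isotropic vector there is a maximum and
    hence orthogonal to everything. *)
Lemma hyperbolic_kernel G a v : (forall i j, G i j = G j i) ->
  hyperbolic G a -> 0 < form G a a -> form G v a = 0 -> form G v v = 0 ->
  forall w, form G v w = 0.
Proof.
move=> Gsym Ghyp aa_gt0 va0 vv0 w.
pose w' i := 1 * w i + (- (form G w a / form G a a)) * a i.
have w'a : form G w' a = 0 by rewrite form_linl mulNr divfK ?gt_eqF//; ring.
have vw' : form G v w' = form G v w by rewrite form_linr va0; ring.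
pose c := form G w' w'; have c_le0 : c <= 0 by apply: Ghyp.
apply/eqP; apply: contraT => b_neq0.
pose b := form G v w; have b2_gt0 : 0 < b ^+ 2 by rewrite exprn_even_gt0.
(* On this combination the form is [b ^+ 2 * (2 - c)], which is positive for nonzero [b] because
   [c <= 0]. *)
pose u i := (1 - c) * v i + b * w' i.
have /Ghyp : form G u a = 0 by rewrite form_linl va0 w'a; ring.
rewrite form_quad // vv0 vw' -/b -/c.
have -> : (1 - c) ^+ 2 * 0 + 2 * (1 - c) * b * b + b ^+ 2 * c
  = b ^+ 2 * (2 - c) by ring.
by rewrite pmulr_rle0 // => ?; lra.
Qed.

Lemma form_delta G v i : form G (fun l => (l == i)%:R) v = app G v i.
Proof.
rewrite /form (bigD1 i) //= eqxx mul1r big1 ?addr0 // => j /negPf ->.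
by rewrite mul0r.
Qed.

Lemma app_delta G i j : app G (fun l => (l == j)%:R) i = G i j.
Proof.
rewrite /app (bigD1 j) //= eqxx mulr1 big1 ?addr0 // => k /negPf ->.
by rewrite mulr0.
Qed.

Lemma hyperbolic_app0 G a v : (forall i j, G i j = G j i) ->
  hyperbolic G a -> 0 < form G a a -> form G v a = 0 -> form G v v = 0 ->
  app G v =1 (fun=> 0).
Proof.
move=> Gsym Ghyp aa va vv i.
by rewrite -form_delta formC // (hyperbolic_kernel Gsym Ghyp aa).
Qed.

(** Equality in [hyperbolic_ineq] makes the component of [u] orthogonal to [a] isotropic, hence a
    kernel vector, which the last hypothesis excludes. *)
Lemma hyperbolic_strict G a u :
  (forall i j, G i j = G j i) -> hyperbolic G a -> 0 < form G a a ->
  ~ app G (fun i => 1 * u i + - (form G u a / form G a a) * a i) =1 (fun=> 0) ->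
  form G u u * form G a a < form G u a ^+ 2.
Proof.
move=> Gsym Ghyp aa_gt0 ker; rewrite lt_def hyperbolic_ineq // andbT.
apply/eqP => e; apply: ker; apply: (hyperbolic_app0 Gsym Ghyp aa_gt0).
  by rewrite form_linl mulNr divfK ?gt_eqF //; ring.
rewrite form_quad // -[form G u u](mulfK (lt0r_neq0 aa_gt0)) -e; field.
exact: lt0r_neq0.
Qed.

Lemma weighted_cauchy_schwarz d z : (forall i, 0 <= d i) ->
  (\sum_i d i * z i) ^+ 2 <= (\sum_i d i) * \sum_i d i * z i ^+ 2.
Proof.
move=> d_ge0; set D := \sum_i d i; set S := \sum_i d i * z i.
set Q := \sum_i d i * z i ^+ 2.
have : 0 <= \sum_i d i * (D * z i - S) ^+ 2.
  by apply: sumr_ge0 => i _; rewrite mulr_ge0 ?sqr_ge0.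
have -> : \sum_i d i * (D * z i - S) ^+ 2 = D ^+ 2 * Q - 2 * D * S * S + S ^+ 2 * D.
  transitivity (\sum_i (D ^+ 2 * (d i * z i ^+ 2) - 2 * D * S * (d i * z i)
    + S ^+ 2 * d i)); first by apply: eq_bigr => i _; ring.
  by rewrite big_split sumrB /= -!mulr_sumr.
have D_ge0 : 0 <= D by apply: sumr_ge0.
have [D0|D_neq0] := eqVneq D 0.
  have d0 i : d i = 0.
    have /eqP := D0; rewrite psumr_eq0 // => /allP/(_ i); rewrite mem_index_enum.
    by move=> /(_ isT)/eqP.
  rewrite D0 mul0r /S big1 ?expr0n // => i _; by rewrite d0 mul0r.
have D_gt0 : 0 < D by rewrite lt_def D_neq0.
have -> : D ^+ 2 * Q - 2 * D * S * S + S ^+ 2 * D = D * (D * Q - S ^+ 2) by ring.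
by rewrite pmulr_rge0 // subr_ge0.
Qed.

End Forms.

(** Bernoulli's inequality bounds [(1 - e) ^+ k] by [1 / (1 + k e)], which the Archimedean property
    makes arbitrarily small. *)
Lemma geometric_le0 (R : archiRealFieldType) (e x y : R) :
  0 < e -> e <= 1 -> (forall k, x <= (1 - e) ^+ k * y) -> x <= 0.
Proof.
move=> e_gt0 e_le1 hx; rewrite leNgt; apply/negP => x_gt0.
have bern k : (1 - e) ^+ k * (1 + k%:R * e) <= 1.
  elim: k => [|k IH]; first by rewrite mul0r addr0 mulr1.
  apply: le_trans IH; rewrite exprSr -mulrA ler_wpM2l ?exprn_ge0 ?subr_ge0 //.
  have : 0 <= k%:R * e by rewrite mulr_ge0 ?ler0n ?ltW.
  by rewrite -natr1; nra.
have y_gt0 : 0 < y by have := hx 0; rewrite expr0 mul1r; lra.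
have [k hk] : exists k, y / (x * e) < k%:R.
  exists (Num.bound (y / (x * e))); apply: le_lt_trans (archi_boundP _).
    by [].
  by rewrite divr_ge0 ?mulr_ge0 ?ltW.
have := hx k; have := bern k; set q := _ ^+ k => bk xk.
rewrite ltr_pdivrMr ?mulr_gt0 // in hk.
have q_ge0 : 0 <= q by rewrite exprn_ge0 ?subr_ge0.
have : x * (1 + k%:R * e) <= y.
  have : x * (1 + k%:R * e) <= q * y * (1 + k%:R * e).
    by rewrite ler_wpM2r // addr_ge0 // mulr_ge0 ?ler0n ?ltW.
  move/le_trans; apply; rewrite mulrAC -[leRHS]mul1r ler_wpM2r // ltW //.
by move=> ?; nra.
Qed.

(** * From hyperbolic contractions to a hyperbolic form *)

Section LocalToGlobal.
(** In the application [t i] is the Hessian of the contraction by [i], and [sum_t] and [app_t] are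
    Euler's relations. The point [a] is only nonnegative, since it vanishes at the homogenising
    variable. *)
Variables (R : archiRealFieldType) (V : finType) (a : V -> R) (H : V -> V -> R).
Variables (c : R) (t : V -> V -> V -> R).
Hypothesis a_ge0 : forall i, 0 <= a i.
Hypothesis H_ge0 : forall i j, 0 <= H i j.
Hypothesis H_sym : forall i j, H i j = H j i.
Hypothesis t_sym : forall i j k, t i j k = t i k j.
Hypothesis c_gt0 : 0 < c.
Hypothesis sum_t : forall j k, \sum_i a i * t i j k = c * H j k.
Hypothesis app_t : forall i j, 0 < a i -> app (t i) a j = c * H i j.
Hypothesis t_hyperbolic : forall i, 0 < a i -> hyperbolic (t i) a.
Hypothesis H_row0 : forall i j, 0 < a i -> app H a i = 0 -> H i j = 0.
Hypothesis H_connected : forall i l, 0 < a i -> 0 < a l ->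
  0 < app H a i -> 0 < app H a l ->
  0 < H i l \/ exists j, [/\ 0 < a j, 0 < H i j & 0 < H l j].

Let h i := app H a i.
Let P v i := app H v i / h i.
(* The operator [T] is selfadjoint for the inner product with weights
   [h i / a i]; it fixes [a] and, in the coordinates [z i = v i / a i], acts as
   the transition operator of a reversible Markov chain. *)
Let T v i := a i * P v i.
(** [B v] is the squared norm of [T v]. The weights [d] are the stationary measure, [nz] is the
    squared norm in the coordinates [z], [az] returns to the coordinates [v], and [L] is the lazy
    chain. *)
Let B v := \sum_i a i * (app H v i ^+ 2 / h i).
Let d i := a i * h i.
Let nz z := \sum_i d i * z i ^+ 2.
Let az (z : V -> R) i := a i * z i.
Let L z i := 2^-1 * z i + 2^-1 * P (az z) i.

Let h_ge0 i : 0 <= h i.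
Proof. by apply: sumr_ge0 => j _; rewrite mulr_ge0. Qed.

Let d_ge0 i : 0 <= d i. Proof. by rewrite mulr_ge0. Qed.

Let a_gt0 i : a i != 0 -> 0 < a i. Proof. by rewrite lt_def a_ge0 andbT. Qed.

Let app0 i v : 0 < a i -> h i = 0 -> app H v i = 0.
Proof. by move=> ai hi; apply: big1 => j _; rewrite H_row0 ?mul0r. Qed.

(** The division in [P] is harmless also for [h i = 0], since then row [i] of [H] vanishes wherever
    [a i > 0]. *)
Let hP i v : a i * (h i * P v i) = a i * app H v i.
Proof.
have [->|/a_gt0 ai] := eqVneq (a i) 0; first by rewrite !mul0r.
rewrite /P; have [hi|hi] := eqVneq (h i) 0; first by rewrite hi mul0r app0.
by field.
Qed.

Let sum_form_t v : c * form H v v = \sum_i a i * form (t i) v v.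
Proof.
rewrite /form /app; under [RHS]eq_bigr do rewrite mulr_sumr.
rewrite mulr_sumr exchange_big; apply: eq_bigr => j _.
under [RHS]eq_bigr do rewrite mulr_sumr mulr_sumr.
rewrite exchange_big !mulr_sumr; apply: eq_bigr => k _.
transitivity (v j * v k * (c * H j k)); first by ring.
by rewrite -sum_t mulr_sumr; apply: eq_bigr => i _; ring.
Qed.

Let form_t_pt i v : 0 < a i -> form (t i) v a = c * app H v i.
Proof.
move=> ai; rewrite /form /app mulr_sumr; apply: eq_bigr => j _.
by have := app_t j ai; rewrite /app => ->; ring.
Qed.

(** Each [form (t j) v v] with [a j > 0] is nonpositive, as [v] is orthogonal to [a], while their
    weighted sum is [c * form H v v = 0]. So all of them vanish, and isotropic vectors orthogonal to
    [a] lie in the kernel. *)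
Lemma kernel_descent v i : app H v =1 (fun=> 0) -> 0 < a i ->
  0 < form (t i) a a -> app (t i) v =1 (fun=> 0).
Proof.
move=> Hv ai aa_gt0; apply: hyperbolic_app0 (t_hyperbolic ai) aa_gt0 _ _ => //.
  by rewrite form_t_pt // Hv mulr0.
have /eqP : \sum_i a i * - form (t i) v v = 0.
  under eq_bigr do rewrite mulrN.
  rewrite sumrN -sum_form_t [form H v v]big1 ?mulr0 ?oppr0 // => j _.
  by rewrite Hv mulr0.
rewrite psumr_eq0 => [/allP/(_ i)|j _].
  by rewrite mem_index_enum mulf_eq0 gt_eqF //= oppr_eq0 => /(_ isT)/eqP.
have [->|/a_gt0 aj] := eqVneq (a j) 0; first by rewrite mul0r.
rewrite mulr_ge0 // oppr_ge0 t_hyperbolic // form_t_pt //.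
by rewrite Hv mulr0.
Qed.

(** Reversed Cauchy-Schwarz for every [t i], summed with the weights [a i]. In operator form:
    [T <= T ^ 2]. *)
Let form_le_B v : form H v v <= B v.
Proof.
rewrite -(ler_pM2l c_gt0) sum_form_t.
rewrite /B mulr_sumr; apply: ler_sum => i _.
have [->|/a_gt0 ai] := eqVneq (a i) 0; first by rewrite !mul0r mulr0.
rewrite mulrCA; apply: ler_wpM2l => //.
have va := form_t_pt v ai; have aa : form (t i) a a = c * h i := form_t_pt a ai.
have [hi|hi] := eqVneq (h i) 0.
  rewrite (app0 _ ai hi) expr0n mul0r mulr0; apply: t_hyperbolic => //.
  by rewrite va (app0 _ ai hi) mulr0.
have hi_gt0 : 0 < h i by rewrite lt_def hi h_ge0.
have aa_gt0 : 0 < form (t i) a a by rewrite aa mulr_gt0.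
have := hyperbolic_ineq v (t_sym i) (t_hyperbolic ai) aa_gt0.
rewrite va aa -ler_pdivlMr ?mulr_gt0 // => /le_trans; apply.
by rewrite le_eqVlt; apply/orP; left; apply/eqP; field; rewrite hi gt_eqF.
Qed.

Let B_nz v : B v = nz (P v).
Proof.
apply: eq_bigr => i _; rewrite /d -mulrA /P.
have [hi|hi] := eqVneq (h i) 0; first by rewrite hi invr0 !(mul0r, mulr0).
by field.
Qed.

(** Cauchy-Schwarz in each row shows that averaging over the chain does not increase the norm:
    [T ^ 2 <= 1]. *)
Let B_az z : B (az z) <= nz z.
Proof.
have -> : nz z = \sum_i a i * \sum_j H i j * a j * z j ^+ 2.
  rewrite /nz; under [RHS]eq_bigr do rewrite mulr_sumr.
  rewrite exchange_big; apply: eq_bigr => i _.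
  rewrite /d /h /app mulr_sumr mulr_suml; apply: eq_bigr => j _.
  by rewrite H_sym; ring.
apply: ler_sum => i _; apply: ler_wpM2l => //.
have CS : app H (az z) i ^+ 2 <= h i * \sum_j H i j * a j * z j ^+ 2.
  have -> : app H (az z) i = \sum_j H i j * a j * z j.
    by apply: eq_bigr => j _; rewrite mulrA.
  by apply: weighted_cauchy_schwarz => j; rewrite mulr_ge0.
have [hi|hi] := eqVneq (h i) 0.
  rewrite hi invr0 mulr0; apply: sumr_ge0 => j _.
  by rewrite mulr_ge0 ?sqr_ge0 // mulr_ge0.
by rewrite ler_pdivrMr ?lt_def ?hi ?h_ge0 // mulrC.
Qed.

Let form_T u v : form H (T u) v = \sum_i a i * (app H u i * app H v i / h i).
Proof. by apply: eq_bigr => i _; rewrite /T /P; ring. Qed.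

Let form_TB v : form H v (T v) = B v.
Proof.
by rewrite formC // form_T; apply: eq_bigr => i _; ring.
Qed.

(* Apply [form_le_B] to [v + T v]: this is the operator inequality
   [T ^ 3 - T >= 0]. *)
Let form_le_T v : form H v v <= form H (T v) (T v).
Proof.
have := form_le_B (fun i => 1 * v i + 1 * T v i).
have -> : B (fun i => 1 * v i + 1 * T v i) = B v + 2 * form H (T v) (T v) + B (T v).
  rewrite form_T /B mulr_sumr -!big_split; apply: eq_bigr => i _ /=.
  by rewrite app_lin; ring.
rewrite form_quad // form_TB.
have : B (T v) <= B v by rewrite [leRHS]B_nz; apply: B_az.
by lra.
Qed.

Let az_L z i : az (L z) i = 2^-1 * az z i + 2^-1 * T (az z) i.
Proof. by rewrite /az /L /T; ring. Qed.

(** In operator form, [T (1 + T) ^ 2 / 4 - T] is half of [T ^ 2 - T] plus a quarter of [T ^ 3 - T],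
    both nonnegative. *)
Let form_le_L z : form H (az z) (az z) <= form H (az (L z)) (az (L z)).
Proof.
rewrite (eq_form H (az_L z) (az_L z)) form_quad // form_TB.
by have := form_le_T (az z); have := form_le_B (az z); lra.
Qed.

(** In operator form, [(1 + T) ^ 2 / 4 <= (1 + T) / 2], because [T ^ 2 <= 1]. *)
Let nz_L z : nz (L z) <= (nz z + form H (az z) (az z)) / 2.
Proof.
have -> : nz (L z) = (nz z + 2 * form H (az z) (az z) + nz (P (az z))) / 4.
  rewrite /form mulr_sumr -!big_split mulr_suml; apply: eq_bigr => i _ /=.
  have := hP i (az z); rewrite /L /d /az => e.
  transitivity ((a i * h i * z i ^+ 2 + 2 * z i * (a i * (h i * P (az z) i))
    + a i * h i * P (az z) i ^+ 2) / 4); first by rewrite /az; field.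
  by rewrite e /az; field.
by rewrite -B_nz; have := B_az z; lra.
Qed.

Let form_az z : form H (az z) a = \sum_i d i * z i.
Proof. by apply: eq_bigr => i _; rewrite /az /d /h; ring. Qed.

Let sum_dP v : \sum_i d i * P v i = form H v a.
Proof.
by rewrite formC //; apply: eq_bigr => i _; rewrite /d -mulrA hP.
Qed.

Let orth_L z : \sum_i d i * z i = 0 -> \sum_i d i * L z i = 0.
Proof.
move=> z0; transitivity (2^-1 * (\sum_i d i * z i) + 2^-1 * \sum_i d i * P (az z) i).
  by rewrite !mulr_sumr -big_split; apply: eq_bigr => i _; rewrite /L /=; ring.
by rewrite sum_dP form_az z0; ring.
Qed.

Let W i j := a i * H i j * a j.
(** The Dirichlet form over ordered pairs, whence the factor two in [E_nz]. *)
Let E z := \sum_i \sum_j W i j * (z i - z j) ^+ 2.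

Let W_ge0 i j : 0 <= W i j. Proof. by rewrite !mulr_ge0. Qed.

Let sum_W i : \sum_j W i j = d i.
Proof. by rewrite /d /h /app mulr_sumr; apply: eq_bigr => j _; rewrite /W mulrA. Qed.

Let E_nz z : E z = 2 * (nz z - form H (az z) (az z)).
Proof.
have e1 : nz z = \sum_i \sum_j W i j * z i ^+ 2.
  by apply: eq_bigr => i _; rewrite -sum_W mulr_suml.
have e2 : nz z = \sum_i \sum_j W i j * z j ^+ 2.
  rewrite exchange_big e1; apply: eq_bigr => i _; apply: eq_bigr => j _.
  by rewrite /W H_sym; ring.
have e3 : form H (az z) (az z) = \sum_i \sum_j W i j * z i * z j.
  apply: eq_bigr => i _; rewrite /app mulr_sumr; apply: eq_bigr => j _.
  by rewrite /W /az; ring.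
rewrite (_ : 2 * _ = nz z + nz z - 2 * form H (az z) (az z)); last by ring.
rewrite {1}e1 e2 e3 mulr_sumr -sumrN -!big_split; apply: eq_bigr => i _ /=.
rewrite mulr_sumr -sumrN -!big_split; apply: eq_bigr => j _ /=; ring.
Qed.

Let E_ge0 z : 0 <= E z.
Proof. by do 2![apply: sumr_ge0 => ? _]; rewrite mulr_ge0 ?sqr_ge0. Qed.

(** A crude common bound for all inverse edge weights; pairs with [W i j = 0] contribute zero. *)
Let C := \sum_i \sum_j (W i j)^-1.

Let C_ge0 : 0 <= C.
Proof. by do 2![apply: sumr_ge0 => ? _]; rewrite invr_ge0. Qed.

Let edge_le z i j : 0 < W i j -> (z i - z j) ^+ 2 <= C * E z.
Proof.
move=> Wij.
have h1 : W i j * (z i - z j) ^+ 2 <= E z.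
  rewrite /E (bigD1 i) //= (bigD1 j) //= -addrA lerDl addr_ge0 //.
    by apply: sumr_ge0 => ? _; rewrite mulr_ge0 ?sqr_ge0.
  by do 2![apply: sumr_ge0 => ? _]; rewrite mulr_ge0 ?sqr_ge0.
have h2 : (W i j)^-1 <= C.
  rewrite /C (bigD1 i) //= (bigD1 j) //= -addrA lerDl addr_ge0 //.
    by apply: sumr_ge0 => ? _; rewrite invr_ge0.
  by do 2![apply: sumr_ge0 => ? _]; rewrite invr_ge0.
have -> : (z i - z j) ^+ 2 = (W i j)^-1 * (W i j * (z i - z j) ^+ 2).
  by rewrite mulKf ?gt_eqF.
by apply: ler_pM => //; rewrite ?invr_ge0 // mulr_ge0 ?sqr_ge0.
Qed.

(** By [H_connected], states of positive weight are at distance at most two. For a path through [j],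
    the parallelogram law bounds [(z i - z l) ^+ 2] by twice the sum of two edge terms, hence the
    constant four. *)
Let dist_le z i l : d i * d l * (z i - z l) ^+ 2 <= d i * d l * (4 * C * E z).
Proof.
have [->|di] := eqVneq (d i) 0; first by rewrite !mul0r.
have [->|dl] := eqVneq (d l) 0; first by rewrite !(mulr0, mul0r).
apply: ler_wpM2l; first by rewrite mulr_ge0.
move: di dl; rewrite /d !mulf_eq0 !negb_or => /andP[/a_gt0 ai hi] /andP[/a_gt0 al hl].
have CE_ge0 : 0 <= C * E z by rewrite mulr_ge0.
have hi_gt0 : 0 < h i by rewrite lt_def hi h_ge0.
have hl_gt0 : 0 < h l by rewrite lt_def hl h_ge0.
have [Hil|[j [aj Hij Hlj]]] := H_connected ai al hi_gt0 hl_gt0.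
  have := @edge_le z i l; rewrite !mulr_gt0 // => /(_ isT); lra.
have := @edge_le z i j; rewrite !mulr_gt0 // => /(_ isT).
have := @edge_le z l j; rewrite !mulr_gt0 // => /(_ isT).
have := sqr_ge0 (z i + z l - 2 * z j).
have -> : 4 * C * E z = 4 * (C * E z) by ring.
nra.
Qed.

(* The Poincare inequality, with an explicit and far from optimal constant. *)
Let poincare z : \sum_i d i * z i = 0 ->
  nz z <= (4 * C * (\sum_i d i) + 1) * (nz z - form H (az z) (az z)).
Proof.
move=> z0; set D := \sum_i d i; set q := form H _ _.
have D_ge0 : 0 <= D by apply: sumr_ge0.
have Enz := E_nz z; rewrite -/q in Enz.
have gap_ge0 : 0 <= nz z - q by have := E_ge0 z; rewrite Enz; lra.
have [D0|D_neq0] := eqVneq D 0.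
  rewrite D0; have : nz z = 0.
    apply: big1 => i _; have /eqP := D0; rewrite psumr_eq0 // => /allP/(_ i).
    by rewrite mem_index_enum => /(_ isT)/eqP ->; rewrite mul0r.
  by lra.
have D_gt0 : 0 < D by rewrite lt_def D_neq0.
have : \sum_i \sum_l d i * d l * (z i - z l) ^+ 2
    <= \sum_i \sum_l d i * d l * (4 * C * E z).
  by apply: ler_sum => i _; apply: ler_sum => l _; apply: dist_le.
have -> : \sum_i \sum_l d i * d l * (4 * C * E z) = D * D * (4 * C * E z).
  rewrite /D mulr_suml mulr_suml; apply: eq_bigr => i _.
  by rewrite mulr_sumr mulr_suml.
have -> : \sum_i \sum_l d i * d l * (z i - z l) ^+ 2 = 2 * D * nz z.
  transitivity (\sum_i (d i * z i ^+ 2 * D - 2 * (d i * z i) * (\sum_l d l * z l)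
     + d i * nz z)).
    apply: eq_bigr => i _; rewrite /D /nz !mulr_sumr -sumrN -!big_split.
    by apply: eq_bigr => l _ /=; ring.
  by rewrite z0 big_split sumrB /= -!mulr_suml -/D -/(nz z); ring.
rewrite Enz => hD.
have : D * nz z <= D * (4 * C * D * (nz z - q)) by nra.
by rewrite ler_pM2l // mulrDl mul1r; lra.
Qed.

(** A lazy step does not decrease the form, yet [nz_L] and the Poincare constant [K] shrink the
    squared norm by the factor [1 - 1 / (2 K)]. *)
Let form_geometric : exists e : R, [/\ 0 < e, e <= 1 &
  forall k z, \sum_i d i * z i = 0 -> form H (az z) (az z) <= (1 - e) ^+ k * nz z].
Proof.
set K := 4 * C * (\sum_i d i) + 1.
have K_ge1 : 1 <= K by rewrite lerDr !mulr_ge0 // sumr_ge0.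
have K_gt0 : 0 < K by apply: lt_le_trans K_ge1.
have iK_gt0 : 0 < K^-1 by rewrite invr_gt0.
have iK_le1 : K^-1 <= 1 by rewrite invf_le1.
exists (K^-1 / 2); split; [by lra | by lra |].
elim=> [|k IH] z z0.
  by rewrite expr0 mul1r; have := E_ge0 z; rewrite E_nz; lra.
apply: le_trans (form_le_L z) _; apply: le_trans (IH _ (orth_L z0)) _.
rewrite exprSr -mulrA; apply: ler_wpM2l; first by rewrite exprn_ge0 //; lra.
apply: le_trans (nz_L z) _.
have := poincare z0; rewrite -/K -ler_pdivrMl // => ?.
by lra.
Qed.

Lemma local_to_global : hyperbolic H a.
Proof.
(* Unlike [v], the vector [T v = az (P v)] has coordinates [z] even where [a] vanishes. *)
move=> v va0; apply: le_trans (form_le_T v) _.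
have [e [e_gt0 e_le1 he]] := form_geometric.
apply: (@geometric_le0 _ e _ (nz (P v))) => // k.
by apply: he; rewrite sum_dP.
Qed.

End LocalToGlobal.

(** * The quadratic form of a partial equivalence relation *)

Section PartialEquivalence.
Variables (R : realFieldType) (V : finType) (e : rel V).
Hypotheses (e_sym : ssrbool.symmetric e) (e_trans : transitive e).

(** These weights add up to one over each class, so that sums over elements become sums over
    classes. Off the domain of the relation the inverse of zero gives weight zero. *)
Definition class_weight (l : V) : R := (#|[pred j | e l j]|%:R)^-1.

Lemma sum_class_weight i : \sum_l (e i l)%:R * class_weight l = (e i i)%:R.
Proof.
have [eii|/negP eii] := boolP (e i i); last first.
  apply: big1 => l _; have [eil|] := boolP (e i l); last by rewrite mul0r.
  by case: eii; apply: (e_trans eil); rewrite e_sym.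
transitivity (\sum_(l | e i l) class_weight i).
  rewrite [RHS]big_mkcond; apply: eq_bigr => l _.
  have [eil|] := boolP (e i l); last by rewrite mul0r.
  rewrite mul1r /class_weight; congr (_%:R^-1); apply: eq_card => j /=.
  rewrite !inE; apply/idP/idP; first exact: e_trans.
  by apply: e_trans; rewrite e_sym.
rewrite sumr_const (_ : #|_| = #|[pred j | e i j]|) //.
rewrite -[LHS]mulr_natl /class_weight mulfV // pnatr_eq0 -lt0n.
by apply/card_gt0P; exists i.
Qed.

Lemma class_weight_ge0 l : 0 <= class_weight l.
Proof. by rewrite invr_ge0 ler0n. Qed.

Lemma class_weight_le l : class_weight l <= (e l l)%:R.
Proof.
rewrite /class_weight; have [ell|/negP ell] := boolP (e l l).
  rewrite invf_le1 ?ler1n ?ltr0n; apply/card_gt0P; by exists l.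
rewrite eq_card0 ?invr0 // => j; rewrite !inE; apply/negP => elj.
by case: ell; apply: (e_trans elj); rewrite e_sym.
Qed.

Lemma class_weight_eq1 l j : class_weight l = 1 -> e l j -> l = j.
Proof.
move=> wl elj.
have ell : e l l by apply: (e_trans elj); rewrite e_sym.
have /eqP : #|[pred j | e l j]| = 1%N.
  apply/eqP; rewrite -(eqr_nat R); apply/eqP.
  by rewrite -[LHS]invrK -/(class_weight l) wl invr1.
move=> /card1P[x /= hx]; have := hx l; have := hx j; rewrite !inE ell elj.
by move=> /esym/eqP -> /esym/eqP ->.
Qed.

Lemma class_form (v : V -> R) : form (fun i j => (e i j)%:R) v v =
  \sum_l class_weight l * (\sum_j (e l j)%:R * v j) ^+ 2.
Proof.
transitivity (\sum_l \sum_i \sum_j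
    class_weight l * (e l i)%:R * (e l j)%:R * v i * v j).
  rewrite exchange_big; apply: eq_bigr => i _; rewrite mulr_sumr.
  rewrite exchange_big; apply: eq_bigr => j _.
  transitivity ((e i j)%:R * (\sum_l (e i l)%:R * class_weight l) * v i * v j).
    rewrite sum_class_weight; have [eij|] := boolP (e i j); last by rewrite !(mul0r, mulr0).
    have -> : e i i by apply: (e_trans eij); rewrite e_sym.
    by rewrite /= mulr1n; ring.
  rewrite mulr_sumr !mulr_suml; apply: eq_bigr => l _.
  have [eil|] := boolP (e l i); rewrite ?(e_sym i l) ?eil; last first.
    by move/negPf ->; rewrite !(mulr0, mul0r).
  have -> : e i j = e l j.
    apply/idP/idP; first exact: e_trans eil.
    by apply: e_trans; rewrite e_sym.
  by rewrite /= mulr1n; ring.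
apply: eq_bigr => l _; rewrite expr2 mulr_suml mulr_sumr.
apply: eq_bigr => i _; rewrite !mulr_sumr.
by apply: eq_bigr => j _; ring.
Qed.

Lemma class_form_ge0 (v : V -> R) : 0 <= form (fun i j => (e i j)%:R) v v.
Proof.
rewrite class_form; apply: sumr_ge0 => l _.
by rewrite mulr_ge0 ?sqr_ge0 ?class_weight_ge0.
Qed.

Lemma sum_class_weight_app (v : V -> R) :
  \sum_l class_weight l * (\sum_j (e l j)%:R * v j) = \sum_i (e i i)%:R * v i.
Proof.
under [RHS]eq_bigr do rewrite -sum_class_weight mulr_suml.
rewrite [RHS]exchange_big; apply: eq_bigr => l _; rewrite mulr_sumr.
by apply: eq_bigr => j _; rewrite e_sym; ring.
Qed.

(** Cauchy-Schwarz over the classes, whose number is the sum of the weights. *)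
Lemma class_form_ge v :
  (\sum_i (e i i)%:R * v i) ^+ 2
    <= (\sum_l class_weight l) * form (fun i j => (e i j)%:R) v v.
Proof.
rewrite class_form -sum_class_weight_app.
by apply: weighted_cauchy_schwarz => l; apply: class_weight_ge0.
Qed.

End PartialEquivalence.

Lemma sum_option (R : nmodType) (T : finType) (f : option T -> R) :
  \sum_o f o = f None + \sum_i f (Some i).
Proof.
rewrite (bigD1 None) //=; congr (_ + _).
rewrite (reindex_omap Some id) /=; last by case.
by apply: eq_bigl => i; rewrite eqxx.
Qed.

Lemma sum_notin (R : pzSemiRingType) n (I : {set 'I_n}) :
  \sum_l (l \notin I)%:R = (n - #|I|)%:R :> R.
Proof.
rewrite -[X in (X - _)%N]card_ord -(cardC I) addKn -sum1_card natr_sum [RHS]big_mkcond.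
by apply: eq_bigr => l _; rewrite !inE; case: ifP.
Qed.

(** * Independence, and parallelism in contractions *)

Section Matroid.
Variables (n : nat) (M : matroid n).
Implicit Types (I J X Y K : {set 'I_n}) (i j k l : 'I_n).

Lemma indep_extend X K : X \in indep M -> K \in indep M -> (#|X| <= #|K|)%N ->
  exists Y, [/\ Y \in indep M, X \subset Y, Y \subset X :|: K & #|Y| = #|K|].
Proof.
move: {2}(#|K| - #|X|)%N (erefl (#|K| - #|X|)%N) => m.
elim: m X => [|m IH] X em X_indep K_indep leXK.
  by exists X; split; rewrite ?subsetUl //; lia.
have [|x] := indep_aug X_indep K_indep; first by lia.
rewrite inE => /andP[xX xK] xX_indep.
have cardx : #|x |: X| = #|X|.+1 by rewrite cardsU1 xX.
have e1 : (#|K| - #|x |: X|)%N = m by lia.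
have e2 : (#|x |: X| <= #|K|)%N by lia.
have [Y [Y_indep sub1 sub2 cardY]] := IH _ e1 xX_indep K_indep e2.
exists Y; split => //; first exact: subset_trans (subsetUr _ _) sub1.
apply: subset_trans sub2 _; rewrite !subUset subsetUl subsetUr sub1set inE.
by rewrite xK orbT.
Qed.

Lemma rank_witness : exists2 K, K \in indep M & #|K| = rank M.
Proof.
have indep_gt0 : (0 < #|indep M|)%N.
  by apply/card_gt0P; exists set0; apply: indep0.
have [K K_indep hK] := eq_bigmax_cond (fun I : {set 'I_n} => #|I|) indep_gt0.
by exists K.
Qed.

Lemma indep_le_rank I : I \in indep M -> (#|I| <= rank M)%N.
Proof. by move=> I_indep; rewrite /rank (bigD1 I) //= leq_maxl. Qed.

Lemma indep_extend_rank X m : X \in indep M -> (#|X| + m <= rank M)%N ->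
  exists J, [/\ [disjoint X & J], #|J| = m & X :|: J \in indep M].
Proof.
move=> X_indep le_rank; have [K K_indep cardK] := rank_witness.
have [|Y [Y_indep XY _ cardY]] := indep_extend X_indep K_indep; first by lia.
have [J sJ cardJ] : exists2 J : {set 'I_n}, J \subset Y :\: X & #|J| = m.
  have /card_geqP[s [us ss hs]] : (m <= #|Y :\: X|)%N.
    by rewrite cardsD (setIidPr XY); lia.
  exists [set x in s]; first by apply/subsetP => x; rewrite inE => /hs.
  by rewrite cardsE (card_uniqP us).
exists J; split => //.
  rewrite disjoint_sym disjoints_subset; apply: subset_trans sJ _.
  by apply/subsetP => x; rewrite !inE => /andP[].
apply: indep_sub Y_indep; rewrite subUset XY; apply: subset_trans sJ _.
exact: subsetDl.
Qed.

(** The non-loops of the contraction [M / I]; [par I] is parallelism among them. Both are empty for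
    dependent [I]. *)
Definition nonloop I i := (i \notin I) && (i |: I \in indep M).

Definition par I : rel 'I_n := [rel i j |
  [&& nonloop I i, nonloop I j & (i == j) || (i |: (j |: I) \notin indep M)]].

Lemma par_refl I i : par I i i = nonloop I i.
Proof. by rewrite /par /= eqxx andbT andbb. Qed.

Lemma par_sym I : ssrbool.symmetric (par I).
Proof. by move=> i j; rewrite /par /= eq_sym setUCA andbCA. Qed.

(** If [i |: (k |: I)] were independent, augmenting [j |: I] from it would add [i] or [k],
    contradicting one of the two parallel pairs. *)
Lemma par_trans I : transitive (par I).
Proof.
move=> j i k; rewrite /par /= => /and3P[nli nlj ij] /and3P[_ nlk jk].
rewrite nli nlk /=; case: (eqVneq i j) ij => [-> //|nij /= ij].
case: (eqVneq j k) jk => [<- //|njk /= jk]; first by rewrite ij orbT.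
case: (eqVneq i k) => //= nik; apply/negP => ik.
have /andP[jI jI_indep] := nlj; have /andP[iI _] := nli; have /andP[kI _] := nlk.
have [|x] := indep_aug jI_indep ik.
  by rewrite !cardsU1 !inE negb_or nik iI jI kI.
rewrite !inE negb_or -andbA => /and3P[xj /negPf ->]; rewrite orbF.
case/orP=> /eqP ->; first by rewrite (negPf ij).
by rewrite setUCA (negPf jk).
Qed.

End Matroid.

Lemma rank_le n (M : matroid n) : (rank M <= n)%N.
Proof. by have [K _ <-] := rank_witness M; rewrite -[leqRHS]card_ord max_card. Qed.

(** Induction on the size of [K]. A smaller [K :\ x] extends to an independent [m]-set [F], so [K]
    lies in [F] plus at most two elements; if [#|K| = m + 2], then [F] is [K] minus two elements. *)
Lemma indep_uniform n (M : matroid n) m (K : {set 'I_n}) :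
  (forall F i j, F \in indep M -> #|F| = m -> i != j -> i \notin F -> j \notin F ->
     i |: (j |: F) \in indep M) ->
  (m.+2 <= rank M)%N -> (#|K| <= m.+2)%N -> K \in indep M.
Proof.
move=> unif le_rank; move: {2}#|K| (erefl #|K|) => t; elim: t K => [|t IH] K cardK le_K.
  by rewrite (cards0_eq cardK) indep0.
have [x xK] : exists x, x \in K by apply/card_gt0P; rewrite cardK.
have cardKx : #|K :\ x| = t by rewrite (cardsD1 x) xK in cardK; lia.
have Kx_indep : K :\ x \in indep M by apply: IH => //; lia.
have [t_le|t_gt] := leqP t m.
  have [|J [dJ cardJ KJ_indep]] := @indep_extend_rank _ M _ (m - t) Kx_indep.
    by rewrite cardKx; lia.
  set F := _ :|: J in KJ_indep.
  have cardF : #|F| = m.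
    by rewrite cardsU disjoint_setI0 // cards0 cardKx cardJ; lia.
  have KF : K \subset x |: F.
    by rewrite -(setD1K xK) setUS // subsetUl.
  clearbody F.
  have [xF|xF] := boolP (x \in F).
    by apply: indep_sub KF _; rewrite (setUidPr _) ?sub1set.
  (* A further element exists because [m + 2 <= rank M <= n]. *)
  have [y yF] : exists y, y \notin x |: F.
    apply/existsP; rewrite -negb_forall; apply/negP => /forallP h.
    have : (#|'I_n| <= #|x |: F|)%N.
      by apply: subset_leq_card; apply/subsetP => z _; apply: h.
    by rewrite card_ord cardsU1 xF cardF; have := rank_le M; lia.
  move: yF; rewrite !inE negb_or => /andP[yx yF].
  apply: indep_sub (subset_trans KF (subsetUr [set y] _)) _.
  exact: unif.
have [y yK] : exists y, y \in K :\ x by apply/card_gt0P; rewrite cardKx; lia.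
rewrite -(setD1K xK) -(setD1K yK); apply: unif.
- by apply: indep_sub Kx_indep; apply: subsetDl.
- by rewrite (cardsD1 y) yK in cardKx; lia.
- by move: yK; rewrite !inE eq_sym => /andP[].
- by rewrite !inE eqxx andbF.
- by rewrite !inE eqxx.
Qed.

(** Take a basis [B] through [i] and [k], also containing [j] if the three are independent, and
    remove [i] and [k]. In the independent case [j] lies in [F]; in the other case an exchange shows
    that [j] and [k] are not parallel in [M / F]. *)
Lemma par_avoid n (M : matroid n) i j k : nonloop M set0 i -> nonloop M set0 j ->
  nonloop M set0 k -> ~~ par M set0 i k -> ~~ par M set0 j k -> i != j ->
  exists F, [/\ F \in indep M, (#|F| + 2 = rank M)%N, nonloop M F i, nonloop M F k
    & ~~ par M F i k /\ ~~ par M F k j].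
Proof.
move=> nli nlj nlk; rewrite /par /= nli nlj nlk !setU0 !negb_or !negbK.
move=> /andP[ik ik_indep] /andP[jk jk_indep] ij.
have [B [B_indep cardB ikB hj]] : exists B, [/\ B \in indep M, #|B| = rank M,
    [set i; k] \subset B & ([set i; j; k] \in indep M) ==> (j \in B)].
  have [X [X_indep ikX hj]] : exists X, [/\ X \in indep M,
    [set i; k] \subset X & ([set i; j; k] \in indep M) ==> (j \in X)].
    have [ijk|_] := boolP ([set i; j; k] \in indep M).
      exists [set i; j; k]; split=> //; last by rewrite !inE eqxx orbT.
      by apply/subsetP => x; rewrite !inE => /orP[] ->; rewrite ?orbT.
    by exists [set i; k].
  have [K K_indep cardK] := rank_witness M.
  have [|B [B_indep XB _ cardB]] := indep_extend X_indep K_indep.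
    by rewrite cardK indep_le_rank.
  exists B; split=> //; [by rewrite cardB | exact: subset_trans XB |].
  by apply/implyP => /(implyP hj); apply: (subsetP XB).
pose F := B :\ i :\ k.
have iB : i \in B by apply: (subsetP ikB); rewrite !inE eqxx.
have kB : k \in B by apply: (subsetP ikB); rewrite !inE eqxx orbT.
have kBi : k \in B :\ i by rewrite !inE eq_sym ik.
have eB : i |: (k |: F) = B by rewrite setD1K // setD1K.
have eB' : k |: (i |: F) = B by rewrite setUCA.
have iF : i \notin F by rewrite !inE eqxx andbF.
have kF : k \notin F by rewrite !inE eqxx.
have cardF : (#|F| + 2 = rank M)%N.
  by rewrite -cardB (cardsD1 i B) iB (cardsD1 k (B :\ i)) kBi -/F addnC.
have F_indep : F \in indep M by apply: indep_sub B_indep; rewrite -eB setUCA -/F setUA subsetUr.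
have nlFi : nonloop M F i.
  by rewrite /nonloop iF; apply: indep_sub B_indep; rewrite -eB' subsetUr.
have nlFk : nonloop M F k.
  by rewrite /nonloop kF; apply: indep_sub B_indep; rewrite -eB subsetUr.
exists F; split=> //; split; first by rewrite nlFi nlFk eB B_indep orbF.
rewrite nlFk /= [k == j]eq_sym (negPf jk) /=; apply/negP => /andP[/andP[jF jF_indep]].
have ijk : [set i; j; k] \notin indep M.
  apply: contra jF => /(implyP hj) jB; rewrite !inE jk jB andbT.
  by rewrite eq_sym.
case/negP.
(* A basis extending [[set j; k]] by elements of [B] cannot contain [i], so it must be
   [k |: (j |: F)]. *)
have [|Y [Y_indep jkY sY cardY]] := indep_extend jk_indep B_indep.
  by rewrite cards2 jk cardB -cardF addn2.
have iY : i \notin Y.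
  apply: contra ijk => iY; apply: indep_sub Y_indep.
  by rewrite -setUA subUset sub1set iY.
apply: indep_sub Y_indep; have sub : Y \subset k |: (j |: F).
  apply/subsetP => x xY; have := subsetP sY x xY; rewrite -eB !inE.
  have: x != i by apply: contraNneq iY => <-.
  by move=> /negPf ->; case: (x == j); case: (x == k); rewrite ?orbT.
have /eqP <- // : Y == k |: (j |: F).
by rewrite eqEcard sub !cardsU1 in_setU1 negb_or kF jF [k == j]eq_sym jk /= cardY cardB -cardF addn2.
Qed.

Lemma disjointsU1 (T : finType) (x : T) (A B : {set T}) :
  [disjoint x |: A & B] = (x \notin B) && [disjoint A & B].
Proof. by rewrite !disjoints_subset subUset sub1set inE. Qed.

(** * Gradients and Hessians of the contractions, and Euler's relations *)

Section Hessian.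
Variables (R : archiRealFieldType) (n : nat) (M : matroid n) (a : 'I_n -> R).
Hypothesis a_gt0 : forall l, 0 < a l.
Implicit Types (I J X Y K : {set 'I_n}) (i j k l : 'I_n) (m s : nat).

(* For independent [I] this is the value at [a] of the generating polynomial of
   the independent [m]-sets of the contraction [M / I]; otherwise it is [0]. *)
Definition contr_gen I m : R :=
  \sum_(J : {set 'I_n} | [&& [disjoint I & J], #|J| == m & I :|: J \in indep M])
    \prod_(l in J) a l.

(** The polynomials are multiaffine, so differentiating in [i] amounts to contracting [i]. In [grad]
    and [hess], [m] is the degree left after differentiation. *)
Definition grad I m i : R := if i \in I then 0 else contr_gen (i |: I) m.

Definition hess I m i j : R := if i \in I then 0 else grad (i |: I) m j.

Lemma contr_gen_ge0 I m : 0 <= contr_gen I m.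
Proof. by apply: sumr_ge0 => J _; apply: prodr_ge0 => l _; apply: ltW. Qed.

Lemma contr_gen_dep I m : I \notin indep M -> contr_gen I m = 0.
Proof.
move=> I_dep; apply: big_pred0 => J; apply/negP => /and3P[_ _ IJ].
by move/negP: I_dep; apply; apply: indep_sub IJ; apply: subsetUl.
Qed.

Lemma contr_gen_gt0 I m : I \in indep M -> (#|I| + m <= rank M)%N ->
  0 < contr_gen I m.
Proof.
move=> I_indep /(indep_extend_rank I_indep)[J [dJ /eqP cJ IJ]].
rewrite /contr_gen (bigD1 J) ?dJ ?cJ //= ltr_wpDr //.
  by apply: sumr_ge0 => ? _; apply: prodr_ge0 => l _; apply: ltW.
by apply: prodr_gt0.
Qed.

Lemma contr_gen0 I : contr_gen I 0 = (I \in indep M)%:R.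
Proof.
have [I_indep|I_dep] := boolP (I \in indep M); last exact: contr_gen_dep.
rewrite /contr_gen (big_pred1 set0) ?big_set0 // => J /=.
rewrite cards_eq0; case: eqP => [->|]; last by rewrite andbF.
by rewrite disjoints_subset setC0 subsetT setU0.
Qed.

(** Euler's relation: every [J] of size [m + 1] is counted once for each of its elements. *)
Lemma sum_grad I m : \sum_i grad I m i * a i = m.+1%:R * contr_gen I m.+1.
Proof.
transitivity (\sum_(J : {set 'I_n} |
    [&& [disjoint I & J], #|J| == m.+1 & I :|: J \in indep M])
    \sum_(i in J) \prod_(l in J) a l); last first.
  rewrite /contr_gen mulr_sumr; apply: eq_bigr => J /and3P[_ /eqP cJ _].
  by rewrite sumr_const cJ mulr_natl.
rewrite (exchange_big_dep xpredT) //=; apply: eq_bigr => i _.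
rewrite /grad; have [iI|iI] := boolP (i \in I).
  rewrite mul0r big_pred0 // => J; apply/negP => /andP[/and3P[dJ _ _] iJ].
  by rewrite (disjointFr dJ iI) in iJ.
rewrite /contr_gen mulr_suml.
rewrite [RHS](reindex_onto (fun J => i |: J) (fun J => J :\ i)) /=; last first.
  by move=> J /andP[_ iJ]; rewrite setD1K.
have sub J : ((i |: J) :\ i == J) = (i \notin J).
  apply/eqP/idP => [<-|iJ]; first by rewrite !inE eqxx.
  by rewrite setU1K.
apply: eq_big => J.
  rewrite sub setU11 andbT; have [iJ|iJ] := boolP (i \in J).
    by rewrite andbF; apply/negP => /and3P[dJ _ _]; rewrite (disjointFr dJ) ?setU11 in iJ.
  rewrite andbT cardsU1 iJ add1n eqSS setUCA setUA.
  by rewrite disjointsU1 iJ [in RHS]disjoint_sym disjointsU1 iI /= disjoint_sym.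
by move=> /and3P[dJ _ _]; rewrite big_setU1 /= 1?mulrC // (disjointFr dJ) ?setU11.
Qed.

Lemma hessC I m i j : hess I m i j = hess I m j i.
Proof.
rewrite /hess /grad !inE (eq_sym j i); case: (i \in I); case: (j \in I) => //.
  by rewrite orbT.
  by rewrite orbT.
by rewrite !orbF; case: eqP => // _; rewrite setUCA.
Qed.

Lemma app_hess I m i : app (hess I m) a i = m.+1%:R * grad I m.+1 i.
Proof.
rewrite /app /hess /grad -/(grad _ _); have [iI|iI] := boolP (i \in I).
  by rewrite mulr0; apply: big1 => j _; rewrite mul0r.
by rewrite sum_grad.
Qed.

Lemma form_hess I m : form (hess I m) a a = (m.+1 * m.+2)%:R * contr_gen I m.+2.
Proof.
rewrite /form; under eq_bigr do rewrite app_hess mulrCA (mulrC (a _)).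
by rewrite -mulr_sumr sum_grad mulrA natrM.
Qed.

Lemma hess_contractC I m i j k :
  (if i \in I then 0 else hess (i |: I) m j k) =
  (if j \in I then 0 else hess (j |: I) m i k).
Proof.
rewrite /hess !inE (eq_sym j i); case: (i \in I); case: (j \in I); rewrite ?orbT //.
by rewrite !orbF; case: eqP => // _; rewrite setUCA.
Qed.

(** Euler's relation for second derivatives, through the symmetry of third derivatives in
    [hess_contractC]. *)
Lemma sum_hess I m j k :
  \sum_i a i * (if i \in I then 0 else hess (i |: I) m j k) = m.+1%:R * hess I m.+1 j k.
Proof.
under eq_bigr do rewrite hess_contractC.
rewrite {2}/hess; have [jI|jI] := boolP (j \in I).
  by rewrite mulr0; apply: big1 => i _; rewrite mulr0.
by rewrite -app_hess; apply: eq_bigr => i _; rewrite hessC mulrC.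
Qed.

Lemma grad_ge0 I m i : 0 <= grad I m i.
Proof. by rewrite /grad; case: ifP => // _; apply: contr_gen_ge0. Qed.

Lemma hess_ge0 I m i j : 0 <= hess I m i j.
Proof. by rewrite /hess; case: ifP => // _; apply: grad_ge0. Qed.

Lemma grad_loop I m i : ~~ nonloop M I i -> grad I m i = 0.
Proof.
by rewrite /nonloop /grad; case: (i \in I) => //=; apply: contr_gen_dep.
Qed.

Lemma grad_gt0 I m i : nonloop M I i -> (#|I| + m.+1 <= rank M)%N -> 0 < grad I m i.
Proof.
move=> /andP[iI iI_indep] le_rank; rewrite /grad (negPf iI) contr_gen_gt0 //.
by rewrite cardsU1 iI; lia.
Qed.

Lemma hess_gt0 I m i j : i \notin I -> nonloop M (i |: I) j ->
  (#|I| + m.+2 <= rank M)%N -> 0 < hess I m i j.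
Proof.
move=> iI nlj le_rank; rewrite /hess (negPf iI) grad_gt0 //.
by rewrite cardsU1 iI; lia.
Qed.

Lemma hess_dep I m i j : i |: I \notin indep M -> hess I m i j = 0.
Proof.
move=> iI; rewrite /hess; case: ifP => // _; apply: grad_loop.
apply: contra iI => /andP[_]; apply: indep_sub; exact: subsetUr.
Qed.

(* Up to the factor [s!], the Hessian at [(a, y = 0)] of
   [\sum_j (N - j)! / (d - j)! f_j y ^ (d - j)], where [f_j] is the generating
   polynomial of the independent [j]-sets of [M / I], [d = m + 2] and
   [N = d + s]; the index [None] stands for the variable [y]. Contracting an
   element decreases [N] and [d] by one and leaves [s] unchanged. *)
Definition ext_hess s I m (o o' : option 'I_n) : R :=
  match o, o' with
  | Some i, Some j => hess I m i j
  | Some i, None | None, Some i => s.+1%:R * grad I m i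
  | None, None => (s.+1 * s.+2)%:R * contr_gen I m
  end.

Definition ext_pt (o : option 'I_n) : R := if o is Some i then a i else 0.

Lemma ext_hessC s I m o o' : ext_hess s I m o o' = ext_hess s I m o' o.
Proof. by case: o o' => [i|] [j|] //=; apply: hessC. Qed.

Lemma ext_hess_ge0 s I m o o' : 0 <= ext_hess s I m o o'.
Proof.
by case: o o' => [i|] [j|] /=; rewrite ?hess_ge0 ?mulr_ge0 ?grad_ge0 ?contr_gen_ge0 ?ler0n.
Qed.

Lemma app_ext_hess s I m o : app (ext_hess s I m) ext_pt o =
  if o is Some i then m.+1%:R * grad I m.+1 i
  else m.+1%:R * (s.+1%:R * contr_gen I m.+1).
Proof.
rewrite /app sum_option /= mulr0 add0r; case: o => [i|] /=.
  exact: app_hess.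
by under eq_bigr do rewrite -mulrA; rewrite -mulr_sumr sum_grad; ring.
Qed.

Lemma form_ext_hess s I m v :
  form (ext_hess s I m) v v = form (hess I m) (v \o some) (v \o some)
   + 2 * v None * s.+1%:R * (\sum_i grad I m i * v (Some i))
   + (s.+1 * s.+2)%:R * v None ^+ 2 * contr_gen I m.
Proof.
rewrite /form /app sum_option sum_option /=.
under [X in _ + X]eq_bigr do rewrite sum_option /= mulrDr.
rewrite big_split /=; set G := \sum_i grad I m i * v (Some i).
have -> : \sum_i s.+1%:R * grad I m i * v (Some i) = s.+1%:R * G.
  by rewrite /G mulr_sumr; apply: eq_bigr => i _; ring.
have -> : \sum_i v (Some i) * (s.+1%:R * grad I m i * v None) = s.+1%:R * v None * G.
  by rewrite /G mulr_sumr; apply: eq_bigr => i _; ring.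
by ring.
Qed.

Lemma form_ext_pt s I m v :
  form (ext_hess s I m) v ext_pt = form (hess I m) (v \o some) a
   + v None * s.+1%:R * m.+1%:R * contr_gen I m.+1.
Proof.
rewrite /form sum_option app_ext_hess addrC; congr (_ + _); last by ring.
by apply: eq_bigr => i _; rewrite app_ext_hess app_hess.
Qed.

(** The family [t] of the local-to-global step; the homogenising variable gets the zero matrix, in
    line with its weight zero in [ext_pt]. *)
Definition ext_contract s I m (o : option 'I_n) : option 'I_n -> option 'I_n -> R :=
  if o is Some i then
    if i \in I then fun _ _ => 0 else ext_hess s (i |: I) m
  else fun _ _ => 0.

Lemma sum_ext_contract s I m o o' :
  \sum_x ext_pt x * ext_contract s I m x o o' = m.+1%:R * ext_hess s I m.+1 o o'.
Proof.
have sumg k : \sum_i a i * (if i \in I then 0 else grad (i |: I) m k)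
    = m.+1%:R * grad I m.+1 k.
  rewrite -app_hess; apply: eq_bigr => i _; rewrite hessC mulrC.
  by rewrite /hess.
rewrite sum_option mul0r add0r.
case: o o' => [j|] [k|] /=.
- by rewrite -sum_hess; apply: eq_bigr => i _; case: ifP.
- rewrite mulrCA -sumg mulr_sumr; apply: eq_bigr => i _.
  by case: ifP => _ /=; ring.
- rewrite mulrCA -sumg mulr_sumr; apply: eq_bigr => i _.
  by case: ifP => _ /=; ring.
rewrite mulrCA -sum_grad mulr_sumr; apply: eq_bigr => i _; rewrite /grad.
by case: ifP => _ /=; ring.
Qed.

Lemma app_ext_contract s I m i o :
  app (ext_contract s I m (Some i)) ext_pt o = m.+1%:R * ext_hess s I m.+1 (Some i) o.
Proof.
rewrite /ext_contract; have [iI|iI] := boolP (i \in I).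
  rewrite /app big1 => [|? _]; last by rewrite mul0r.
  by case: o => [j|] /=; rewrite /hess /grad iI !mulr0.
rewrite app_ext_hess; case: o => [j|] /=; rewrite /hess /grad (negPf iI) //.
Qed.

Lemma form_ext_pt_pt s I m : form (ext_hess s I m) ext_pt ext_pt =
  (m.+1 * m.+2)%:R * contr_gen I m.+2.
Proof. by rewrite form_ext_pt !mul0r addr0 -form_hess. Qed.

(** * Hyperbolicity: degree two, then induction on the degree *)

Lemma grad0 I i : grad I 0 i = (par M I i i)%:R.
Proof.
by rewrite par_refl /grad /nonloop contr_gen0; case: ifP.
Qed.

Lemma hess0 I i j :
  hess I 0 i j = (par M I i i)%:R * (par M I j j)%:R - (par M I i j)%:R.
Proof.
rewrite !par_refl /hess /grad contr_gen0 /par /= !inE.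
have [nli|] := boolP (nonloop M I i); last first.
  rewrite mul0r subr0 /nonloop; case: (i \in I) => //= iI.
  case: ifP => // _; case: (boolP (_ \in _)) => // h; case/negP: iI.
  by apply: indep_sub h; apply: subsetUr.
have [nlj|] := boolP (nonloop M I j); last first.
  rewrite mulr0 /= subr0 /nonloop; case: (j \in I) => /= jI; first by rewrite orbT if_same.
  rewrite orbF; case: ifP => // _; case: ifP => // _; case: (boolP (_ \in _)) => // h.
  case/negP: jI; apply: indep_sub h; rewrite setUCA; apply: subsetUr.
case/andP: nli => /negPf -> iI; case/andP: nlj => /negPf -> jI.
rewrite orbF eq_sym; case: eqP => [<-|_] /=; first by rewrite mulr1 subrr.
by rewrite setUCA; case: (_ \in _) => /=; rewrite mulr1 ?subr0 ?subrr.
Qed.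

Lemma sum_class_weight_le I : I \in indep M ->
  \sum_l class_weight R (par M I) l <= (n - #|I|)%:R.
Proof.
move=> I_indep; rewrite -sum_notin; apply: ler_sum => l _; apply: le_trans (class_weight_le _ (@par_sym _ M I) (@par_trans _ M I) l) _.
by rewrite par_refl ler_nat /nonloop; case: (l \in I); case: (_ \in _).
Qed.

Lemma app_hess0 I v i : app (hess I 0) v i =
  (par M I i i)%:R * (\sum_l (par M I l l)%:R * v l) - \sum_l (par M I i l)%:R * v l.
Proof.
rewrite /app mulr_sumr -sumrB; apply: eq_bigr => l _; rewrite hess0; ring.
Qed.

Lemma form_hess0 I v : form (hess I 0) v v =
  (\sum_l (par M I l l)%:R * v l) ^+ 2 - form (fun i j => (par M I i j)%:R) v v.
Proof.
rewrite /form; under eq_bigr do rewrite app_hess0 mulrBr.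
rewrite sumrB; congr (_ - _).
rewrite expr2 [in RHS]mulr_suml; apply: eq_bigr => i _; ring.
Qed.

(** [M / I] has at most [n - #|I| = s + 2] parallel classes. Cauchy-Schwarz over them bounds the
    form by a multiple of the square of one linear functional. *)
Lemma ext_hess0_hyperbolic s I : I \in indep M -> (#|I| + 2 <= rank M)%N ->
  (#|I| + 2 + s = n)%N -> hyperbolic (ext_hess s I 0) ext_pt.
Proof.
move=> I_indep le_rank en.
pose S (v : option 'I_n -> R) := \sum_l (par M I l l)%:R * v (Some l).
have key v : form (ext_hess s I 0) v v <=
    s.+1%:R / s.+2%:R * (S v + s.+2%:R * v None) ^+ 2.
  rewrite form_ext_hess form_hess0 contr_gen0 I_indep /=.
  under [\sum_i grad _ _ _ * _]eq_bigr do rewrite grad0.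
  rewrite -/(S v); set E := form _ _ _.
  have hE : S v ^+ 2 <= s.+2%:R * E.
    apply: le_trans (class_form_ge (@par_sym _ M I) (@par_trans _ M I) _) _.
    have := sum_class_weight_le I_indep; rewrite (_ : (n - #|I|)%N = s.+2); last by lia.
    set W := \sum_l _ => hW; rewrite -/E; apply: ler_wpM2r => //.
    exact: class_form_ge0 (@par_sym _ M I) (@par_trans _ M I) _.
  rewrite natrM; have s2 : 0 < s.+2%:R :> R by rewrite ltr0n.
  rewrite -(ler_pM2l s2).
  have -> : s.+2%:R * (s.+1%:R / s.+2%:R * (S v + s.+2%:R * v None) ^+ 2)
    = s.+1%:R * (S v + s.+2%:R * v None) ^+ 2.
    by rewrite mulrA [_ * (_ / _)]mulrC divfK ?gt_eqF.
  have : s.+2%:R = s.+1%:R + 1 :> R by rewrite natr1.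
  move: s2 hE; set p := s.+2%:R; set q := s.+1%:R => s2 hE ep.
  suff : p * (S v ^+ 2 - E) <= q * S v ^+ 2 by rewrite ep; lra.
  by rewrite ep; rewrite ep in hE; lra.
(* This [t] moves [v] along [ext_pt] into the kernel of that functional; by orthogonality the form
   changes only by adding a nonnegative multiple of [t ^+ 2]. *)
move=> v va0; pose t := (S v + s.+2%:R * v None) / S ext_pt.
have := key (fun o => 1 * v o + (- t) * ext_pt o).
rewrite form_quad; last by apply: ext_hessC.
rewrite va0.
have S_gt0 : 0 < S ext_pt.
  have -> : S ext_pt = 1%:R * contr_gen I 1.
    by rewrite -sum_grad; apply: eq_bigr => l _; rewrite grad0.
  by rewrite mulr_gt0 ?contr_gen_gt0 //; lia.
have aa_ge0 : 0 <= form (ext_hess s I 0) ext_pt ext_pt.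
  by rewrite form_ext_pt_pt mulr_ge0 ?contr_gen_ge0 ?ler0n.
have -> : S (fun o => 1 * v o + (- t) * ext_pt o) = S v - t * S ext_pt.
  rewrite /S mulr_sumr -sumrB; apply: eq_bigr => l _; ring.
rewrite /= divfK ?gt_eqF //.
have -> : S v - (S v + s.+2%:R * v None) + s.+2%:R * (1 * v None + - t * 0) = 0 by ring.
rewrite expr0n mulr0 expr1n mul1r mulr0 addr0 sqrrN; apply: le_trans.
by rewrite lerDl mulr_ge0 ?sqr_ge0.
Qed.

Lemma ext_hess_dep s I m o o' : I \notin indep M -> ext_hess s I m o o' = 0.
Proof.
move=> I_dep; have sub K : I \subset K -> K \notin indep M.
  by move=> IK; apply: contra I_dep; apply: indep_sub.
have g m' i : grad I m' i = 0.
  by rewrite /grad; case: ifP => // _; rewrite contr_gen_dep // sub ?subsetUr.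
case: o o' => [i|] [j|] /=; rewrite ?g ?contr_gen_dep ?mulr0 //.
by rewrite hess_dep // sub ?subsetUr.
Qed.

Lemma ext_hess_row0 s I m i o : (#|I| + m.+2 <= rank M)%N ->
  app (ext_hess s I m) ext_pt (Some i) = 0 -> ext_hess s I m (Some i) o = 0.
Proof.
move=> le_rank; rewrite app_ext_hess.
have [nli|nli] := boolP (nonloop M I i).
  by move=> /eqP; rewrite mulf_eq0 pnatr_eq0 /= gt_eqF ?grad_gt0.
move=> _; case: o => [j|] /=; last by rewrite grad_loop ?mulr0.
rewrite /hess; case: ifP => // iI; apply: grad_loop.
move: nli; rewrite /nonloop iI /=; apply: contra => /andP[_].
by apply: indep_sub; apply: subsetUr.
Qed.

(** Non-parallel non-loops of [M / I] are joined directly. Parallel ones share as neighbour any [j]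
    independent of [i] in [M / I], which the rank bound provides. *)
Lemma ext_hess_connected s I m (o o' : option 'I_n) :
  I \in indep M -> (#|I| + m.+2 <= rank M)%N -> 0 < ext_pt o -> 0 < ext_pt o' ->
  0 < app (ext_hess s I m) ext_pt o -> 0 < app (ext_hess s I m) ext_pt o' ->
  0 < ext_hess s I m o o' \/
  exists x, [/\ 0 < ext_pt x, 0 < ext_hess s I m o x & 0 < ext_hess s I m o' x].
Proof.
move=> I_indep le_rank; case: o => [i|]; case: o' => [l|] /=; rewrite ?ltxx // => _ _.
have nl k : 0 < app (ext_hess s I m) ext_pt (Some k) -> nonloop M I k.
  rewrite app_ext_hess; apply: contraTT => nlk.
  by rewrite grad_loop // mulr0 ltxx.
move=> /nl nli /nl nll; have [iI iI_indep] := andP nli; have [lI lI_indep] := andP nll.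
have hpos k j : nonloop M I k -> nonloop M I j -> ~~ par M I k j -> 0 < hess I m k j.
  move=> nlk nlj; rewrite /par /= nlk nlj negb_or negbK => /andP[kj h].
  have [kI _] := andP nlk; apply: hess_gt0 => //; rewrite /nonloop !inE.
  by rewrite negb_or eq_sym kj setUCA h; case/andP: nlj => ->.
have [il|] := boolP (par M I i l); last by left; apply: hpos.
right; have [|J [dJ cJ iJ]] := indep_extend_rank (m := 1) iI_indep _.
  by rewrite cardsU1 iI; lia.
move: cJ dJ iJ => /eqP/cards1P[j ->]; rewrite disjoint_sym disjoints_subset sub1set !inE negb_or => /andP[ji jI].
rewrite setUC setUCA => ijI.
have nlj : nonloop M I j.
  by rewrite /nonloop jI; apply: indep_sub ijI; apply: subsetUr.
have ij : ~~ par M I i j.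
  by rewrite /par /= negb_and negb_and negb_or negbK eq_sym ji ijI !orbT.
exists (Some j); split; [exact: a_gt0 | exact: hpos | apply: hpos => //].
by apply: contra ij; apply: (@par_trans _ M I).
Qed.

Lemma ext_contract_hyperbolic s I m i :
  (i \notin I -> i |: I \in indep M -> hyperbolic (ext_hess s (i |: I) m) ext_pt) ->
  hyperbolic (ext_contract s I m (Some i)) ext_pt.
Proof.
rewrite /ext_contract; have [iI _ v _|iI hyp] := boolP (i \in I).
  by rewrite /form big1 // => o _; rewrite /app big1 ?mulr0 // => *; rewrite mul0r.
have [|iI_dep v _] := boolP (i |: I \in indep M); first exact: hyp.
rewrite /form big1 // => o _; rewrite /app big1 ?mulr0 // => o' _.
by rewrite ext_hess_dep ?mul0r.
Qed.

Lemma ext_hess_hyperbolic s I m : I \in indep M -> (#|I| + m.+2 <= rank M)%N ->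
  (#|I| + m.+2 + s = n)%N -> hyperbolic (ext_hess s I m) ext_pt.
Proof.
elim: m I => [|m IH] I I_indep le_rank en; first exact: ext_hess0_hyperbolic.
apply: (@local_to_global _ _ _ _ m.+1%:R (ext_contract s I m)).
- by case=> [i|] //=; apply: ltW.
- exact: ext_hess_ge0.
- exact: ext_hessC.
- case=> [i|] //= o o'; case: ifP => // _; exact: ext_hessC.
- by rewrite ltr0n.
- exact: sum_ext_contract.
- by case=> [i|] o /=; rewrite ?ltxx // => _; exact: app_ext_contract.
- case=> [i _|]; rewrite ?ltxx //; apply: ext_contract_hyperbolic => iI iI_indep.
  by apply: IH => //; rewrite cardsU1 iI; lia.
- case=> [i|] o /=; rewrite ?ltxx // => _; exact: ext_hess_row0.
- by move=> o o'; apply: ext_hess_connected.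
Qed.
End Hessian.

(** * Excluding equality through kernel vectors *)

Section Strictness.
Variables (R : archiRealFieldType) (n : nat) (M : matroid n) (a : 'I_n -> R).
Hypothesis a_gt0 : forall l, 0 < a l.
Implicit Types (F I J K : {set 'I_n}) (i j k l : 'I_n) (m s : nat).

(** [kernel_descent], iterated while the elements of [F] outside [I] are contracted one at a
    time. *)
Lemma ext_kernel_descent s I m v F : I \in indep M -> (#|I| + m.+2 <= rank M)%N ->
  (#|I| + m.+2 + s = n)%N -> app (ext_hess M a s I m) v =1 (fun=> 0) ->
  I \subset F -> F \in indep M -> #|F| = (#|I| + m)%N ->
  app (ext_hess M a s F 0) v =1 (fun=> 0).
Proof.
elim: m I => [|m IH] I I_indep le_rank en Hv IF F_indep cardF.
  have /eqP <- // : I == F by rewrite eqEcard IF cardF addn0 leqnn.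
have /subsetPn[i iF iI] : ~~ (F \subset I).
  by apply/negP => /subset_leq_card; lia.
have iIF : i |: I \subset F by rewrite subUset sub1set iF.
have iI_indep : i |: I \in indep M by apply: indep_sub F_indep.
have cardiI : #|i |: I| = #|I|.+1 by rewrite cardsU1 iI.
apply: (IH (i |: I)) => //; rewrite ?cardiI; try lia.
have -> : ext_hess M a s (i |: I) m = ext_contract M a s I m (Some i).
  by rewrite /ext_contract (negPf iI).
apply: (kernel_descent _ _ (@sum_ext_contract _ _ _ _ _ _ _) _ _ Hv) => /=.
- by case=> [l|] //=; apply: ltW.
- case=> [l|] //= o o'; case: ifP => // _; exact: ext_hessC.
- by case=> [l|] o /=; rewrite ?ltxx // => _; exact: app_ext_contract.
- case=> [l _|]; rewrite ?ltxx //; apply: ext_contract_hyperbolic => lI lI_indep.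
  by apply: ext_hess_hyperbolic => //; rewrite cardsU1 lI; lia.
- exact: a_gt0.
- rewrite (negPf iI) form_ext_pt_pt mulr_gt0 ?ltr0n // contr_gen_gt0 // cardiI; lia.
Qed.

(** The kernel equations make every class sum equal to the total [S] of all class sums. As [i] and
    [k] lie in different classes, there are at least two, so [S = 0]. *)
Lemma hess0_kernel_class F w i k : app (hess M a F 0) w =1 (fun=> 0) ->
  nonloop M F i -> nonloop M F k -> ~~ par M F i k ->
  \sum_l (par M F k l)%:R * w l = 0.
Proof.
move=> Hw nli nlk ik; pose e := par M F; set S := \sum_l (e l l)%:R * w l.
have WS x : \sum_l (e x l)%:R * w l = (e x x)%:R * S.
  by apply/eqP; rewrite eq_sym -subr_eq0 -(app_hess0 M a) Hw.
have Om : 2 <= \sum_x class_weight R e x * (e x x)%:R.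
  have -> : 2 = \sum_x ((e i x)%:R * class_weight R e x + (e k x)%:R * class_weight R e x).
    rewrite big_split !sum_class_weight; try exact: par_sym; try exact: par_trans.
    by rewrite /e !par_refl nli nlk.
  apply: ler_sum => x _; rewrite -mulrDl mulrC ler_wpM2l ?class_weight_ge0 //.
  rewrite -natrD ler_nat.
  have [ix|_] := boolP (e i x); have [kx|_] := boolP (e k x) => //.
  - by case/negP: ik; apply: par_trans ix _; rewrite par_sym.
  - by rewrite /e (par_trans (y := i)) // par_sym.
  - by rewrite /e (par_trans (y := k)) // par_sym.
have : S * (\sum_x class_weight R e x * (e x x)%:R - 1) = 0.
  rewrite mulrBr mulr1 {2}/S -sum_class_weight_app; try exact: par_sym; try exact: par_trans.
  apply/eqP; rewrite subr_eq0 mulr_sumr; apply/eqP; apply: eq_bigr => x _.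
  by rewrite WS; ring.
move/eqP; rewrite mulf_eq0 => /orP[/eqP S0|/eqP]; last by lra.
by rewrite [LHS]WS S0 mulr0.
Qed.

(** The row of the homogenising variable gives [S = - (s + 2)], and the other rows make each class
    sum [-1]. So there are [s + 2 = n - #|F|] classes: every element outside [F] is a non-loop alone
    in its class. *)
Lemma ext_hess0_kernel s F v i j : F \in indep M -> (#|F| + 2 + s = n)%N ->
  v None = 1 -> app (ext_hess M a s F 0) v =1 (fun=> 0) ->
  i != j -> i \notin F -> j \notin F -> i |: (j |: F) \in indep M.
Proof.
move=> F_indep en v1 Hv ij iF jF; pose e := par M F; pose w l := v (Some l).
pose om := class_weight R e.
set S := \sum_l (e l l)%:R * w l.
have hS : S = - s.+2%:R.
  have := Hv None; rewrite /app sum_option /= contr_gen0 F_indep v1 !mulr1.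
  under eq_bigr do rewrite grad0 -mulrA.
  rewrite -mulr_sumr natrM -mulrDr -/e => /eqP.
  by rewrite mulf_eq0 pnatr_eq0 /= addrC addr_eq0 => /eqP.
have hW x : \sum_l (e x l)%:R * w l = - (e x x)%:R.
  have := Hv (Some x); rewrite /app sum_option /= v1 mulr1 grad0.
  rewrite -/(app _ w x) app_hess0 -/e -/S hS.
  have -> : s.+2%:R = s.+1%:R + 1 :> R by rewrite natr1.
  by move=> ?; lra.
have sum_om : \sum_x om x * (e x x)%:R = s.+2%:R.
  apply: oppr_inj; rewrite -hS /S -sum_class_weight_app; try exact: par_sym; try exact: par_trans.
  by rewrite -sumrN; apply: eq_bigr => x _; rewrite hW mulrN.
have om_le x : om x * (e x x)%:R <= (x \notin F)%:R.
  apply: le_trans (_ : (e x x)%:R <= _).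
    rewrite -[leRHS]mul1r ler_wpM2r // (le_trans (class_weight_le _ _ _ _)) ?lern1 ?leq_b1 //.
      exact: par_sym.
    exact: par_trans.
  by rewrite /e par_refl ler_nat /nonloop; case: (x \in F); case: (_ \in _).
have om1 x : x \notin F -> om x * (e x x)%:R = 1.
  move=> xF; apply/eqP; rewrite eq_sym -subr_eq0.
  have /eqP : \sum_x ((x \notin F)%:R - om x * (e x x)%:R) = 0.
    by rewrite sumrB sum_om sum_notin (_ : (n - #|F|)%N = s.+2) ?subrr //; lia.
  rewrite psumr_eq0 => [/allP/(_ x)|y _]; last by rewrite subr_ge0.
  by rewrite mem_index_enum xF => /(_ isT).
have nl x : x \notin F -> nonloop M F x /\ om x = 1.
  move=> /om1; rewrite /e par_refl; case: nonloop => /=; first by rewrite mulr1.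
  by rewrite mulr0 => /eqP; rewrite eq_sym oner_eq0.
have [[nli omi] [nlj _]] := (nl i iF, nl j jF).
apply: contraNT ij => h; apply/eqP.
apply: (class_weight_eq1 (@par_sym _ M F) (@par_trans _ M F) omi).
by rewrite /par /= nli nlj h orbT.
Qed.
(** The strict reversed Cauchy-Schwarz inequality for a vector supported on [i] and [j]; the
    diagonal of the Hessian vanishes, so only the mixed derivative enters. *)
Lemma hess_lt m i j k : rank M = m.+2 -> nonloop M set0 i -> nonloop M set0 j ->
  nonloop M set0 k -> ~~ par M set0 i k -> ~~ par M set0 j k ->
  m.+2%:R * (contr_gen M a set0 m.+2 * hess M a set0 m i j) <
  2 * m.+1%:R * (grad M a set0 m.+1 i * grad M a set0 m.+1 j).
Proof.
move=> er nli nlj nlk ik jk.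
have gi_gt0 : 0 < grad M a set0 m.+1 i by rewrite grad_gt0 ?cards0 ?er.
have gj_gt0 : 0 < grad M a set0 m.+1 j by rewrite grad_gt0 ?cards0 ?er.
have f_gt0 : 0 < contr_gen M a set0 m.+2 by rewrite contr_gen_gt0 ?indep0 ?cards0 ?er.
have hess_diag l : hess M a set0 m l l = 0 by rewrite /hess /grad !inE eqxx.
have [<-|ij] := eqVneq i j; first by rewrite hess_diag !mulr0 !mulr_gt0 ?ltr0n.
pose s := (n - m.+2)%N; have en : (#|set0 : {set 'I_n}| + m.+2 + s = n)%N.
  by rewrite cards0 add0n subnKC // -er rank_le.
have le_rank : (#|set0 : {set 'I_n}| + m.+2 <= rank M)%N by rewrite cards0 er.
pose H := ext_hess M a s set0 m; pose pt := ext_pt a.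
have Hhyp : hyperbolic H pt by apply: ext_hess_hyperbolic; rewrite ?indep0.
have Hsym o o' : H o o' = H o' o by apply: ext_hessC.
have A_gt0 : 0 < form H pt pt by rewrite form_ext_pt_pt mulr_gt0 ?ltr0n.
set c := hess _ _ _ _ i j; set gi := grad _ _ _ _ i in gi_gt0 *.
set gj := grad _ _ _ _ j in gj_gt0 *; set f := contr_gen _ _ _ _ in f_gt0 *.
(* [p] and [q] are the values of [app H pt] at [i] and [j]; weighting [i] by [q] and [j] by [p]
   makes the two terms of [form H u pt] equal. *)
pose p := m.+1%:R * gi; pose q := m.+1%:R * gj.
have p_gt0 : 0 < p by rewrite mulr_gt0 ?ltr0n.
have q_gt0 : 0 < q by rewrite mulr_gt0 ?ltr0n.
pose u o := q * (o == Some i)%:R + p * (o == Some j)%:R.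
have formu v : form H u v = q * app H v (Some i) + p * app H v (Some j).
  by rewrite form_linl !form_delta.
have u_pt : form H u pt = 2 * p * q by rewrite formu !app_ext_hess -/gi -/gj /p /q; ring.
have u_u : form H u u = 2 * p * q * c.
  have appu o : app H u o = q * H o (Some i) + p * H o (Some j).
    by rewrite app_lin !app_delta.
  by rewrite formu !appu /H /= !hess_diag [hess _ _ _ _ j i]hessC -/c; ring.
have : form H u u * form H pt pt < form H u pt ^+ 2.
  apply: hyperbolic_strict => // ker.
  set ka := form H u pt / form H pt pt in ker.
  have ka_gt0 : 0 < ka by rewrite divr_gt0 // u_pt !mulr_gt0 ?ltr0n.
  clearbody ka; have [F [F_indep cardF nlFi nlFk [ikF kjF]]] := par_avoid nli nlj nlk ik jk ij.
  set v := (fun o => _) in ker.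
  have Fker : app (ext_hess M a s F 0) v =1 (fun=> 0).
    apply: (ext_kernel_descent (indep0 M) le_rank en ker) => //; first exact: sub0set.
    by rewrite cards0; apply/eqP; rewrite -(eqn_add2r 2) cardF er addn2.
  have v0 : v None = 0 by rewrite /v /u /pt /=; ring.
  have Fker' : app (hess M a F 0) (v \o some) =1 (fun=> 0).
    move=> x; have := Fker (Some x); rewrite {1}/app sum_option /= => <-.
    by rewrite v0 mulr0 add0r.
  have := hess0_kernel_class Fker' nlFi nlFk ikF.
  (* The class of [k] in [M / F] avoids [i] and [j], so there the kernel vector is a negative
     multiple of [a] and its class sum cannot vanish. *)
  have vl l : (par M F k l)%:R * (v \o some) l = (par M F k l)%:R * - (ka * a l).
    have [kl|] := boolP (par M F k l); last by rewrite !mul0r.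
    have /negPf li : l != i by apply: contraNneq ikF => <-; rewrite par_sym.
    have /negPf lj : l != j by apply: contraNneq kjF => <-.
    rewrite /= /v /u /pt /= -[Some l == Some i]/(l == i) -[Some l == Some j]/(l == j).
    by rewrite li lj /= !mulr0n; ring.
  under eq_bigr do rewrite vl.
  rewrite (bigD1 k) //= par_refl nlFk => /eqP; apply/negP; rewrite lt_eqF //.
  rewrite ltr_wnDr ?mul1r ?oppr_lt0 ?mulr_gt0 //.
  apply: sumr_le0 => l _; rewrite mulrN oppr_le0.
  by apply: mulr_ge0 => //; apply: mulr_ge0; apply: ltW.
rewrite u_u u_pt form_ext_pt_pt -/f natrM.
have -> : 2 * p * q * c * (m.+1%:R * m.+2%:R * f)
  = (2 * p * q * m.+1%:R) * (m.+2%:R * (f * c)) by ring.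
have -> : (2 * p * q) ^+ 2 = (2 * p * q * m.+1%:R) * (2 * m.+1%:R * (gi * gj)).
  by rewrite /p /q; ring.
by rewrite ltr_pM2l // !mulr_gt0 ?ltr0n.
Qed.

(** The test vector is the unit vector of the homogenising variable. Equality would give a kernel
    vector with entry one there, so by [ext_hess0_kernel] and [indep_uniform] the set [K] would be
    independent. *)
Lemma contr_gen_lt m s K : (m.+2 + s = n)%N -> (m.+2 <= rank M)%N ->
  (#|K| <= m.+2)%N -> K \notin indep M ->
  s.+2%:R * m.+2%:R * (contr_gen M a set0 m * contr_gen M a set0 m.+2) <
  s.+1%:R * m.+1%:R * contr_gen M a set0 m.+1 ^+ 2.
Proof.
move=> en' rk le_K K_dep.
have en : (#|set0 : {set 'I_n}| + m.+2 + s = n)%N by rewrite cards0.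
have le_rank : (#|set0 : {set 'I_n}| + m.+2 <= rank M)%N by rewrite cards0.
pose H := ext_hess M a s set0 m; pose pt := ext_pt a.
have Hhyp : hyperbolic H pt by apply: ext_hess_hyperbolic; rewrite ?indep0.
have Hsym o o' : H o o' = H o' o by apply: ext_hessC.
have f_gt0 : 0 < contr_gen M a set0 m.+2 by rewrite contr_gen_gt0 ?indep0.
have A_gt0 : 0 < form H pt pt by rewrite form_ext_pt_pt mulr_gt0 ?ltr0n.
pose u (o : option 'I_n) : R := (o == None)%:R.
have u_pt : form H u pt = m.+1%:R * (s.+1%:R * contr_gen M a set0 m.+1).
  by rewrite form_delta app_ext_hess.
have u_u : form H u u = (s.+1 * s.+2)%:R * contr_gen M a set0 m.
  by rewrite form_delta app_delta.
have : form H u u * form H pt pt < form H u pt ^+ 2.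
  apply: hyperbolic_strict => // ker; case/negP: K_dep.
  apply: indep_uniform le_K => // F i j F_indep cardF ij iF jF.
  have cardF' : #|F| = (#|set0 : {set 'I_n}| + m)%N by rewrite cards0.
  have Fker := ext_kernel_descent (indep0 M) le_rank en ker (sub0set F) F_indep cardF'.
  apply: (ext_hess0_kernel F_indep _ _ Fker ij iF jF); first by rewrite cardF -en' addn2.
  by rewrite /= /u /=; ring.
rewrite u_u u_pt form_ext_pt_pt !natrM.
set f0 := contr_gen _ _ _ m; set f1 := contr_gen _ _ _ m.+1; set f2 := contr_gen _ _ _ m.+2.
have -> : s.+1%:R * s.+2%:R * f0 * (m.+1%:R * m.+2%:R * f2)
  = (s.+1%:R * m.+1%:R) * (s.+2%:R * m.+2%:R * (f0 * f2)) by ring.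
have -> : (m.+1%:R * (s.+1%:R * f1)) ^+ 2
  = (s.+1%:R * m.+1%:R) * (s.+1%:R * m.+1%:R * f1 ^+ 2) by ring.
by rewrite ltr_pM2l // !mulr_gt0 ?ltr0n.
Qed.
End Strictness.

(** * Generating polynomials and their formal derivatives *)

Section Polynomials.
Variables (R : archiRealFieldType) (n : nat) (M : matroid n).
Implicit Types (I J B : {set 'I_n}) (i : 'I_n).

Definition contr_poly I m : {mpoly R[n]} :=
  \sum_(J : {set 'I_n} | [&& [disjoint I & J], #|J| == m & I :|: J \in indep M])
    \prod_(l in J) 'X_l.

Lemma meval_contr_poly a I m : (contr_poly I m).@[a] = contr_gen M a I m.
Proof.
rewrite /contr_poly raddf_sum; apply: eq_bigr => J _ /=.
by rewrite rmorph_prod; apply: eq_bigr => l _ /=; rewrite mevalXU.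
Qed.

Lemma mderiv_prod_notin i J : i \notin J -> (\prod_(l in J) 'X_l : {mpoly R[n]})^`M(i) = 0.
Proof.
move=> iJ; apply: (big_ind (fun p : {mpoly R[n]} => p^`M(i) = 0)).
- by rewrite -mpolyC1 mderivC.
- by move=> p q p0 q0; rewrite mderivM p0 q0 mul0r mulr0 addr0.
move=> l lJ; rewrite mderivX mnm1E; case: eqP => [li|_]; last by rewrite scale0r.
by rewrite -li lJ in iJ.
Qed.

Lemma mderiv_prod_in i J : i \notin J ->
  (\prod_(l in i |: J) 'X_l : {mpoly R[n]})^`M(i) = \prod_(l in J) 'X_l.
Proof.
move=> iJ; rewrite big_setU1 //= mderivM mderiv_prod_notin // mulr0 addr0.
have sub0 : (U_(i) - U_(i) = 0 :> 'X_{1..n})%MM by rewrite -{1}[U_(i)%MM]add0m addmK.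
by rewrite mderivX mnm1E eqxx scale1r sub0 mpolyX0 mul1r.
Qed.

Lemma mderiv_contr_poly i I m :
  (contr_poly I m.+1)^`M(i) = if i \in I then 0 else contr_poly (i |: I) m.
Proof.
rewrite /contr_poly raddf_sum /= (bigID (fun J => i \in J)) /= addrC big1 ?add0r; last first.
  by move=> J /andP[_]; apply: mderiv_prod_notin.
have [iI|iI] := boolP (i \in I).
  by rewrite big_pred0 // => J; apply/negP => /andP[/and3P[dJ _ _]]; rewrite (disjointFr dJ iI).
rewrite (reindex_onto (fun J => i |: J) (fun J => J :\ i)) /=; last first.
  by move=> J /andP[_ iJ]; rewrite setD1K.
have sub J : ((i |: J) :\ i == J) = (i \notin J).
  apply/eqP/idP => [<-|iJ]; first by rewrite !inE eqxx.
  by rewrite setU1K.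
apply: eq_big => J; last by rewrite sub => /andP[_ iJ]; exact: mderiv_prod_in.
rewrite sub setU11 andbT; have [iJ|iJ] := boolP (i \in J).
  by rewrite andbF; apply/esym/negP => /and3P[dJ _ _]; rewrite (disjointFr dJ) ?setU11 in iJ.
rewrite andbT cardsU1 iJ add1n eqSS setUCA setUA.
by rewrite disjointsU1 iJ [in LHS]disjoint_sym disjointsU1 iI /= disjoint_sym.
Qed.

End Polynomials.

(** * Bases, loops, parallel classes and girth in terms of independent sets, and the two
    inequalities *)

Lemma mem_bases n (M : matroid n) B : (B \in bases M) = (B \in indep M) && (#|B| == rank M).
Proof.
rewrite inE; apply/maxsetP/andP => /= [[B_indep hB]|[B_indep /eqP cardB]].
  split=> //; rewrite eqn_leq indep_le_rank //=.
  have [K K_indep <-] := rank_witness M.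
  rewrite leqNgt; apply/negP => ltBK; have [x] := indep_aug B_indep K_indep ltBK.
  rewrite inE => /andP[xB _] /hB/(_ (subsetUr _ _)) e.
  by rewrite -e setU11 in xB.
split=> // C C_indep BC; apply/esym/eqP.
by rewrite eqEcard BC cardB indep_le_rank.
Qed.

Lemma basis_poly_contr (R : realType) n (M : matroid n) :
  basis_poly M R = contr_poly R M set0 (rank M).
Proof.
apply: eq_bigl => B; rewrite mem_bases set0U andbC.
by rewrite disjoint_sym disjoints_subset setC0 subsetT.
Qed.

Lemma indep_poly_contr (R : realType) n (M : matroid n) k :
  indep_poly M R k = contr_poly R M set0 k.
Proof.
apply: eq_bigl => B; rewrite inE set0U andbC.
by rewrite disjoint_sym disjoints_subset setC0 subsetT.
Qed.

Lemma loopE n (M : matroid n) i : loop M i = ~~ nonloop M set0 i.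
Proof.
rewrite /loop /nonloop !inE setU0 /=; apply/minsetP/idP => [[]|i_dep] //.
split=> // D D_dep; rewrite subset1 => /orP[/eqP //|/eqP D0].
by rewrite D0 inE indep0 in D_dep.
Qed.

Lemma parallelE n (M : matroid n) i j : nonloop M set0 i -> nonloop M set0 j ->
  parallel M i j = par M set0 i j.
Proof.
move=> nli nlj; rewrite /par /parallel /= nli nlj /= setU0; case: eqVneq => //= ij.
rewrite inE; apply/minsetP/idP => [[]|dep] //.
split=> // D D_dep sD; apply/eqP; rewrite eqEsubset sD /=.
have sub1 k l : nonloop M set0 k -> D \subset [set k; l] -> l \in D.
  move=> /andP[_]; rewrite setU0 => k_indep sDkl; apply: contraR D_dep => lD.
  apply: indep_sub k_indep; apply/subsetP => x xD.
  have := subsetP sDkl x xD; rewrite !inE => /orP[//|/eqP xl].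
  by rewrite -xl xD in lD.
by rewrite subUset !sub1set (sub1 i j) // (sub1 j i) // setUC.
Qed.

(** Otherwise every parallel class would be that of [i] or that of [j]. *)
Lemma exists_nonparallel n (M : matroid n) i j :
  nonloop M set0 i -> nonloop M set0 j -> (3 <= #|parallel_classes M|)%N ->
  exists k, [/\ nonloop M set0 k, ~~ par M set0 i k & ~~ par M set0 j k].
Proof.
move=> nli nlj; set S := [set x | ~~ loop M x].
have SE x : (x \in S) = nonloop M set0 x by rewrite inE loopE negbK.
pose cl x := [set y in S | parallel M x y].
case: (pickP (fun k => [&& nonloop M set0 k, ~~ par M set0 i k & ~~ par M set0 j k])).
  by move=> k /and3P[]; exists k.
move=> none; suff /subset_leq_card : parallel_classes M \subset [set cl i; cl j].
  by rewrite cards2; case: (_ != _) => /= h1 h2; have := leq_trans h2 h1.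
apply/subsetP => C /imsetP[k]; rewrite SE => nlk ->.
have clE x : nonloop M set0 x -> par M set0 x k -> [set y in S | parallel M k y] = cl x.
  move=> nlx xk; apply/setP => y; rewrite !inE loopE negbK.
  have [nly|] //= := boolP (nonloop M set0 y); rewrite !parallelE //.
  by apply/idP/idP; apply: par_trans => //; rewrite par_sym.
have := none k; rewrite nlk /= !inE => /negbT; rewrite negb_and !negbK.
by case/orP => /clE ->; rewrite ?eqxx ?orbT.
Qed.

(** If all sets of size at most [k] were independent, every size entering the minimum would exceed
    [k], and so does the default [n.+1]. *)
Lemma girth_le_dep n (M : matroid n) k : (k < n.+1)%N -> (girth M <= k)%N ->
  exists2 K : {set 'I_n}, (#|K| <= k)%N & K \notin indep M.
Proof.
move=> kn; rewrite leqNgt => girth_le.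
case: (pickP (fun K : {set 'I_n} => (#|K| <= k)%N && (K \notin indep M))) => [K /andP[]|h].
  by exists K.
case/negP: girth_le; rewrite /girth; elim/big_ind: _ => //.
  by move=> x y; rewrite leq_min => -> ->.
move=> l; apply: contraR; rewrite -leqNgt => lk.
have -> : indep_of_size M l = [set A : {set 'I_n} | #|A| == l].
  apply/setP => K; rewrite !inE andbC; case: eqP => //= cardK.
  by have := h K; rewrite cardK lk /= => /negbFE.
by rewrite card_draws card_ord.
Qed.

Theorem theorem4p4 (R : realType) (n r : nat) (M : matroid n) (i j : 'I_n)
    (hrank : rank M = r) (hr : (2 <= r)%N) :
  (~~ loop M i -> ~~ loop M j -> (3 <= #|parallel_classes M|)%N ->
   forall a : 'I_n -> R, (forall l : 'I_n, 0 < a l) ->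
   (basis_poly M R).@[a] * ((basis_poly M R)^`M(j)^`M(i)).@[a] <
   2 * (1 - r%:R^-1) *
     (((basis_poly M R)^`M(i)).@[a] * ((basis_poly M R)^`M(j)).@[a]))
  /\
  (forall a : 'I_n -> R, (forall l : 'I_n, 0 < a l) ->
   forall k : nat, (1 <= k <= r - 1)%N -> (girth M <= k + 1)%N ->
   ((indep_poly M R (k - 1)).@[a] / 'C(n, k - 1)%:R) *
     ((indep_poly M R (k + 1)).@[a] / 'C(n, k + 1)%:R) <
   ((indep_poly M R k).@[a] / 'C(n, k)%:R) ^+ 2).
Proof.
split.
  rewrite !loopE !negbK => nli nlj /(exists_nonparallel nli nlj)[k [nlk ik jk]] a a_gt0.
  case: r hrank hr => [|[|m]] // er _.
  have dE x : (contr_poly R M set0 m.+2)^`M(x) = contr_poly R M (x |: set0) m.+1.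
    by rewrite mderiv_contr_poly in_set0.
  rewrite basis_poly_contr er !dE mderiv_contr_poly.
  have := hess_lt a_gt0 er nli nlj nlk ik jk.
  have -> : (if i \in j |: set0 then 0 else contr_poly R M (i |: (j |: set0)) m).@[a]
      = hess M a set0 m i j.
    by rewrite hessC /hess /grad in_set0; case: ifP; rewrite ?meval0 ?meval_contr_poly.
  rewrite /grad !in_set0 !meval_contr_poly.
  set f := contr_gen _ _ _ _; set c := hess _ _ _ _ _ _; set gi := contr_gen _ _ _ _.
  set gj := contr_gen _ _ _ _ => h.
  have r_gt0 : 0 < m.+2%:R :> R by rewrite ltr0n.
  rewrite -(ltr_pM2l r_gt0); apply: lt_le_trans h _.
  (* With [r = m + 2] the factor [m + 1] is [r * (1 - r^-1)]. *)
  have -> : m.+1%:R = m.+2%:R - 1 :> R by rewrite -[m.+2%:R]natr1 addrK.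
  move: (m.+2%:R) r_gt0 => x x_gt0; rewrite le_eqVlt; apply/orP; left; apply/eqP.
  by field; rewrite gt_eqF.
move=> a a_gt0 [|m] //; rewrite subn1 addn1 /= => km.
have rk : (m.+2 <= rank M)%N by rewrite hrank; lia.
have rkn := rank_le M.
have kn : (m.+2 < n.+1)%N by lia.
move=> /(girth_le_dep kn)[K le_K K_dep].
pose s := (n - m.+2)%N; have en : (m.+2 + s = n)%N by rewrite /s; lia.
have := contr_gen_lt a_gt0 en rk le_K K_dep.
rewrite !indep_poly_contr !meval_contr_poly subn1 /=.
set f0 := contr_gen _ _ _ m; set f1 := contr_gen _ _ _ m.+1; set f2 := contr_gen _ _ _ m.+2.
(* Since [n - m = s + 2], the ratios of consecutive binomial coefficients turn the constants of
   [contr_gen_lt] into the normalisation by binomials. *)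
have e1 : m.+1%:R * 'C(n, m.+1)%:R = s.+2%:R * 'C(n, m)%:R :> R.
  by rewrite -!natrM mul_bin_left; congr (_ * _)%:R; lia.
have e2 : m.+2%:R * 'C(n, m.+2)%:R = s.+1%:R * 'C(n, m.+1)%:R :> R.
  by rewrite -!natrM mul_bin_left; congr (_ * _)%:R; lia.
have b0 : 0 < 'C(n, m)%:R :> R by rewrite ltr0n bin_gt0; lia.
have b1 : 0 < 'C(n, m.+1)%:R :> R by rewrite ltr0n bin_gt0; lia.
have b2 : 0 < 'C(n, m.+2)%:R :> R by rewrite ltr0n bin_gt0; lia.
move: 'C(n, m)%:R 'C(n, m.+1)%:R 'C(n, m.+2)%:R e1 e2 b0 b1 b2 => B0 B1 B2.
have: 0 < m.+1%:R :> R by rewrite ltr0n.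
have: 0 < m.+2%:R :> R by rewrite ltr0n.
have: 0 < s.+1%:R :> R by rewrite ltr0n.
have: 0 < s.+2%:R :> R by rewrite ltr0n.
move: m.+1%:R m.+2%:R s.+1%:R s.+2%:R => w y z x x0 z0 y0 w0 e1 e2 b0 b1 b2 h.
have {e1} -> : B0 = w * B1 / x by rewrite e1 mulrAC mulfV ?mul1r ?gt_eqF.
have {e2} -> : B2 = z * B1 / y by rewrite -e2 mulrAC mulfV ?mul1r ?gt_eqF.
have -> : f0 / (w * B1 / x) * (f2 / (z * B1 / y)) = x * y * (f0 * f2) / (z * w * B1 ^+ 2).
  by field; rewrite !gt_eqF.
have -> : (f1 / B1) ^+ 2 = z * w * f1 ^+ 2 / (z * w * B1 ^+ 2).
  by field; rewrite !gt_eqF.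
by rewrite ltr_pM2r // invr_gt0 !mulr_gt0 ?exprn_gt0.
Qed.
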